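(* Let $-1<\alpha\le\beta<1$ and $\hat E:=[-1,\alpha]\cup[\beta,1]$. Then $$\operatorname{cap}\hat E\;\ge\;C_1:=\frac12\left(\frac{\sqrt[4]{1-\alpha^2}+\sqrt[4]{1-\beta^2}}{\sqrt[4]{(1-\alpha)(1+\beta)}+\sqrt[4]{(1+\alpha)(1-\beta)}}\right)^4.$$ Equality is attained if $\alpha=\beta$, and in the limits $\alpha\to-1$ (with $\beta$ fixed) and $\beta\to1$ (with $\alpha$ fixed), i.e. in each of these two limits $\operatorname{cap}\hat E$ and $C_1$ converge to the same value.
   Context: For a compact set $\hat E\subset\mathbb{R}$ which is a finite union of nondegenerate intervals, $\operatorname{cap}\hat E$ denotes the logarithmic capacity (Chebyshev constant), $$\operatorname{cap}\hat E:=\lim_{n\to\infty}\sqrt[n]{L_n(\hat E)},\qquad L_n(\hat E):=\min\Bigl\{\max_{x\in\hat E}|P_n(x)| : P_n \text{ a monic real polynomial of degree } n\Bigr\};$$ the limit is known to exist. All roots are the nonnegative real roots. *)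

(* Defs.v *)
From mathcomp Require Import all_boot all_order all_algebra.
From mathcomp Require Import all_classical all_reals all_analysis.

Set Implicit Arguments.
Unset Strict Implicit.
Unset Printing Implicit Defensive.

Import Order.TTheory GRing.Theory Num.Theory.
Import numFieldNormedType.Exports.

Local Open Scope classical_set_scope.
Local Open Scope ring_scope.

(* For [0 <= x] and [0 < n] this is the nonnegative real [n]-th root. For
   [n = 0] it is [1], which no limit in [n] sees. *)
Definition nroot (R : realType) (n : nat) (x : R) : R := x `^ (n%:R^-1).

Definition poly_norm (R : realType) (E : set R) (p : {poly R}) : R :=
  sup [set `|p.[x]| | x in E].

(* On an infinite compact [E] the supremum in [poly_norm] and the infimum here
   are attained. *)
Definition cheb_min (R : realType) (E : set R) (n : nat) : R :=
  inf [set poly_norm E p | p in [set p | p \is monic /\ size p = n.+1]].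

Definition cap (R : realType) (E : set R) : R :=
  lim (nroot n (cheb_min E n) @[n --> \oo]).

Definition two_intervals (R : realType) (a b : R) : set R :=
  `[-1, a] `|` `[b, 1].

Definition C1 (R : realType) (a b : R) : R :=
  2^-1 * ((nroot 4 (1 - a ^+ 2) + nroot 4 (1 - b ^+ 2)) /
          (nroot 4 ((1 - a) * (1 + b)) + nroot 4 ((1 + a) * (1 - b)))) ^+ 4.

(* Main.v *)
(* A monic p of degree n is compared with a Chebyshev-like rational function.
   Substitute x = X(z) / Y(z), of degree 4, which maps
   F = [-1/m, -m] u [m, 1/m] into E; let A = N / (Y K), of degree 8, be a
   rational function that runs four times through [-1, 1] on each component of
   F. Both x and A have a simple pole at a point t between the components. If
   |p| <= M on E with M too small, choose c with |c| M < 1 such that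
   T_n(A) - c p(x), multiplied by (Y K)^n, vanishes at t. By alternation it
   also has 8 n zeros on F, but its degree is at most 8 n. The outcome is
   M >= 2 C1^n. The function A is found by applying two descending Landen
   transformations to the complement of E and then bounding the Green function
   of the resulting symmetric pair of intervals by that of the single interval
   onto which z - 1/z maps each of its components.

   The upper bounds in the limit cases come from Chebyshev polynomials of the
   surviving interval with one additional zero at the vanishing component. *)

Require Import Defs.
From mathcomp Require Import all_boot all_order all_algebra.
From mathcomp Require Import all_classical all_reals all_analysis.
From mathcomp Require Import ring lra.

Set Implicit Arguments.
Unset Strict Implicit.
Unset Printing Implicit Defensive.

Import Order.TTheory GRing.Theory Num.Theory.
Import numFieldNormedType.Exports.

Local Open Scope classical_set_scope.
Local Open Scope ring_scope.

(** * Homogeneous Chebyshev polynomials *)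

(** This is [y ^ n * T_n (x / y)] with the division cleared, so that it makes sense for polynomials
    and at zeros of [y]. *)
Fixpoint cheb (A : comPzRingType) (x y : A) (n : nat) : A :=
  if n is n1.+1 then
    if n1 is n2.+1 then 2 * x * cheb x y n1 - y ^+ 2 * cheb x y n2 else x
  else 1.

Lemma chebSS (A : comPzRingType) (x y : A) n :
  cheb x y n.+2 = 2 * x * cheb x y n.+1 - y ^+ 2 * cheb x y n.
Proof. by []. Qed.

Lemma nat_ind2 (P : nat -> Prop) :
  P 0 -> P 1 -> (forall n, P n -> P n.+1 -> P n.+2) -> forall n, P n.
Proof.
move=> P0 P1 PS n; suff: P n /\ P n.+1 by case.
by elim: n => // n [Pn Pn1]; split=> //; apply: PS.
Qed.

Lemma rmorph_cheb (A B : comPzRingType) (f : {rmorphism A -> B}) x y n :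
  f (cheb x y n) = cheb (f x) (f y) n.
Proof.
elim/nat_ind2: n => [||n IH0 IH1]; rewrite ?rmorph1 //.
by rewrite !chebSS rmorphB ![in LHS]rmorphM rmorph_nat IH0 IH1.
Qed.

Lemma horner_cheb (A : comNzRingType) (p q : {poly A}) n z :
  (cheb p q n).[z] = cheb p.[z] q.[z] n.
Proof. exact: (rmorph_cheb (horner_eval z)). Qed.

Lemma cheb_cos (R : realType) (u d : R) n :
  cheb (cos u * d) d n = cos (n%:R * u) * d ^+ n.
Proof.
elim/nat_ind2: n => [||n IH0 IH1].
- by rewrite mul0r cos0 expr0 mulr1.
- by rewrite mul1r expr1.
have cosSS : cos (n.+2%:R * u) = 2 * cos u * cos (n.+1%:R * u) - cos (n%:R * u).
  have -> : n.+2%:R * u = n.+1%:R * u + u by rewrite -[n.+2]addn1 natrD; ring.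
  have -> : n%:R * u = n.+1%:R * u - u by rewrite -[n.+1]addn1 natrD; ring.
  by rewrite !cosD cosN sinN; ring.
by rewrite chebSS IH0 IH1 cosSS !exprS; ring.
Qed.

(** At a pole of [x / y] only the leading coefficient of the Chebyshev polynomial survives. *)
Lemma cheb_0r (A : comPzRingType) (x : A) n : cheb x 0 n.+1 = 2 ^+ n * x ^+ n.+1.
Proof.
elim: n => [|n IH]; first by rewrite expr0 expr1 mul1r.
by rewrite chebSS IH expr0n mul0r subr0 [in RHS]exprS [x ^+ n.+2]exprS; ring.
Qed.

(** * Degree bounds and homogenization *)

Lemma size_mul_deg (A : nzRingType) (p q : {poly A}) d e :
  (size p <= d.+1)%N -> (size q <= e.+1)%N -> (size (p * q)%R <= (d + e).+1)%N.
Proof.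
move=> hp hq; apply: leq_trans (size_polyMleq p q) _.
rewrite -subn1 leq_subLR add1n; apply: leq_trans (leq_add hp hq) _.
by rewrite addnS addSn.
Qed.

Lemma size_exp_deg (A : nzRingType) (p : {poly A}) d n :
  (size p <= d.+1)%N -> (size (p ^+ n)%R <= (n * d).+1)%N.
Proof.
move=> hp; elim: n => [|n IH]; first by rewrite expr0 size_poly1.
by rewrite exprS mulSn; apply: size_mul_deg.
Qed.

Lemma size_add_deg (A : nzRingType) (p q : {poly A}) d :
  (size p <= d)%N -> (size q <= d)%N -> (size (p + q)%R <= d)%N.
Proof. by move=> hp hq; rewrite (leq_trans (size_polyD p q)) // geq_max hp hq. Qed.

Lemma size_cheb (A : comNzRingType) (p q : {poly A}) d n :
  (size p <= d.+1)%N -> (size q <= d.+1)%N -> (size (cheb p q n) <= (n * d).+1)%N.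
Proof.
move=> hp hq; elim/nat_ind2: n => [||n IH0 IH1].
- by rewrite size_poly1.
- by rewrite mul1n.
rewrite chebSS; apply: size_add_deg.
  rewrite mulr_natl mulrnAl -scaler_nat.
  by apply: leq_trans (size_scale_leq _ _) _; rewrite mulSn; apply: size_mul_deg.
rewrite size_polyN (_ : n.+2 * d = 2 * d + n * d)%N; last by rewrite -addn2
    mulnDl addnC.
by apply: size_mul_deg => //; apply: size_exp_deg.
Qed.

(** This is [y ^ n * p (x / y)] with denominators cleared; [f] embeds the coefficients, so that [x]
    and [y] may be numbers ([f = id]) or polynomials ([f = polyC]). *)
Definition homog (A B : comNzRingType) (f : A -> B) (p : {poly A}) (x y : B) n :
    B :=
  \sum_(i < n.+1) f p`_i * x ^+ i * y ^+ (n - i).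

Lemma horner_homog (A : comNzRingType) (p x y : {poly A}) n z :
  (homog polyC p x y n).[z] = homog id p x.[z] y.[z] n.
Proof.
rewrite /homog horner_sum; apply: eq_bigr => i _.
by rewrite !hornerM hornerC !horner_exp.
Qed.

Lemma size_homog (A : comNzRingType) (p x y : {poly A}) d n :
  (size x <= d.+1)%N -> (size y <= d.+1)%N ->
  (size (homog polyC p x y n) <= (n * d).+1)%N.
Proof.
move=> hx hy; apply: leq_trans (size_sum _ _ _) _.
apply/bigmax_leqP => i _; rewrite -mulrA mul_polyC.
apply: leq_trans (size_scale_leq _ _) _.
have -> : (n * d = i * d + (n - i) * d)%N by rewrite -mulnDl subnKC // -ltnS.
by apply: size_mul_deg; apply: size_exp_deg.
Qed.

Lemma homog_div (F : fieldType) (p : {poly F}) (x y : F) n :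
  (size p <= n.+1)%N -> y != 0 -> homog id p x y n = y ^+ n * p.[x / y].
Proof.
move=> hp y0; rewrite (horner_coef_wide _ hp) mulr_sumr.
apply: eq_bigr => i _; rewrite -mulrA [RHS]mulrCA; congr (_ * _).
have in_n : (i <= n)%N by rewrite -ltnS.
have -> : y ^+ n = y ^+ (n - i) * y ^+ i by rewrite -exprD subnK.
by rewrite expr_div_n -mulrA [y ^+ i * _]mulrC divfK ?expf_neq0 // mulrC.
Qed.

Lemma homog_0r (A : comNzRingType) (p : {poly A}) (x : A) n :
  homog id p x 0 n = p`_n * x ^+ n.
Proof.
rewrite /homog big_ord_recr /= subnn expr0 mulr1 big1 ?add0r // => i _.
by rewrite expr0n subn_eq0 leqNgt ltn_ord /= mulr0.
Qed.

(** * Counting zeros by alternation *)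

Definition zeros_in (R : realFieldType) (g : {poly R}) (a b : R) (k : nat) :=
  exists rs : seq R,
    [/\ size rs = k, uniq rs, all (fun z => a < z < b) rs & all (root g) rs].

(** Because the intervals are open, the two lists of roots are disjoint. *)
Lemma zeros_in_cat (R : realFieldType) (g : {poly R}) (a b c : R) k l :
  a <= b -> b <= c -> zeros_in g a b k -> zeros_in g b c l -> zeros_in g a c (k +
      l).
Proof.
move=> ab bc [r [<- ur ar rr]] [s [<- us as_ rs]]; exists (r ++ s); split.
- by rewrite size_cat.
- rewrite cat_uniq ur us andbT /=; apply/hasPn => z zs; apply/negP => zr.
  have /andP[_ zb] := allP ar _ zr; have /andP[bz _] := allP as_ _ zs.
  by have := lt_trans bz zb; rewrite ltxx.
- rewrite all_cat; apply/andP; split; apply/allP => z.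
    by move=> /(allP ar)/andP[-> /lt_le_trans->].
  by move=> /(allP as_)/andP[/(le_lt_trans ab)-> ->].
- by rewrite all_cat rr.
Qed.

Lemma zeros_in_sub (R : realFieldType) (g : {poly R}) (a b a' b' : R) k :
  a' <= a -> b <= b' -> zeros_in g a b k -> zeros_in g a' b' k.
Proof.
move=> aa bb [r [<- ur ar rr]]; exists r; split=> //.
by apply/allP => z /(allP ar)/andP[/(le_lt_trans aa)-> /lt_le_trans->].
Qed.

Lemma zeros_in1 (R : realType) (g q : {poly R}) (a b : R) n :
  a <= b -> (forall z, a <= z <= b -> q.[z] != 0) ->
  (g.[a] / q.[a] ^+ n) * (g.[b] / q.[b] ^+ n) < 0 -> zeros_in g a b 1.
Proof.
move=> ab q0 sgn.
have cont : {within `[a, b], continuous (fun z => g.[z] / q.[z] ^+ n)}.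
  apply: continuous_in_subspaceT => z; rewrite inE /= in_itv /= => zab.
  apply: cvgM; first exact: continuous_horner.
  apply: cvgV; first by rewrite expf_neq0 ?q0.
  rewrite -horner_exp; under eq_fun do rewrite -horner_exp.
  exact: continuous_horner.
have [|z] := IVT (v := 0) ab cont.
  move: sgn; set u := g.[a] / _; set v := g.[b] / _ => sgn.
  rewrite ge_min le_max.
  by case: (leP u 0) => u0 /=; case: (leP 0 v) => v0 //=; nra.
rewrite in_itv /= => zab /eqP; rewrite mulf_eq0 invr_eq0 expf_eq0.
rewrite (negPf (q0 _ zab)) andbF orbF => gz.
have /andP[az zb] := zab.
exists [:: z]; split=> //=; rewrite andbT //.
rewrite !lt_neqAle az zb !andbT; apply/andP; split; apply/eqP => zE; move: sgn.
  by rewrite zE (eqP gz) !mul0r ltxx.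
by rewrite -zE (eqP gz) mul0r mulr0 ltxx.
Qed.

Lemma IVT_decr (R : realType) (p q : {poly R}) (a b v : R) :
  a <= b -> (forall z, a <= z <= b -> q.[z] != 0) ->
  p.[b] / q.[b] <= v <= p.[a] / q.[a] ->
  exists2 z, a <= z <= b & p.[z] / q.[z] = v.
Proof.
move=> ab q0 /andP[bv va].
have cont : {within `[a, b], continuous (fun z => p.[z] / q.[z])}.
  apply: continuous_in_subspaceT => z; rewrite inE /= in_itv /= => zab.
  apply: cvgM; first exact: continuous_horner.
  by apply: cvgV; [rewrite q0|exact: continuous_horner].
have [|z] := IVT (v := v) ab cont; first by rewrite ge_min le_max bv va orbT.
by rewrite in_itv /= => zab zv; exists z.
Qed.

Lemma cos_natpi (R : realType) n : cos (n%:R * pi) = (-1) ^+ n :> R.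
Proof.
elim: n => [|n IH]; first by rewrite mul0r cos0 expr0.
by rewrite -addn1 natrD mulrDl mul1r cosDpi IH addn1 exprS mulN1r.
Qed.

Lemma mul_near_signs_lt0 (R : realFieldType) (x y e : R) :
  e ^+ 2 = 1 -> `|x - e| < 1 -> `|y + e| < 1 -> x * y < 0.
Proof.
move=> /eqP; rewrite sqrf_eq1 => /orP[] /eqP ->; rewrite !ltr_norml => /andP[? ?]
    /andP[? ?]; nra.
Qed.

(* The points where [p / q = s cos (j pi / n)] exist in increasing order by the
   intermediate value theorem, and [g / q ^ n] alternates in sign along them. *)
Lemma arc_zeros (R : realType) (g p q : {poly R}) (a b s : R) n :
  a <= b -> s ^+ 2 = 1 -> (forall z, a <= z <= b -> q.[z] != 0) ->
  p.[a] = s * q.[a] -> p.[b] = - s * q.[b] ->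
  (forall z, a <= z <= b -> `|g.[z] - (cheb p q n).[z]| < `|q.[z]| ^+ n) ->
  zeros_in g a b n.
Proof.
case: n => [|n]; first by move=> *; exists [::].
move=> ab s1 q0 pa pb gT; set w : R := pi / n.+1%:R.
have s0 : s != 0 by apply/eqP => s0; move: s1; rewrite s0 expr0n /= => /eqP;
    rewrite eq_sym oner_eq0.
have wpos : 0 < w by rewrite divr_gt0 // pi_gt0.
have wn : n.+1%:R * w = pi by rewrite /w mulrC divfK // pnatr_eq0.
(* At such a point the Chebyshev polynomial of degree [n + 1] takes the value
   [s ^ (n + 1) * (-1) ^ j], of modulus one. *)
have close z j : a <= z <= b -> p.[z] / q.[z] = s * cos (j%:R * w) ->
    `|g.[z] / q.[z] ^+ n.+1 - s ^+ n.+1 * (-1) ^+ j| < 1.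
  move=> zab zj; have qz := q0 z zab.
  have := gT z zab; rewrite horner_cheb.
  have -> : cheb p.[z] q.[z] n.+1 = s ^+ n.+1 * (-1) ^+ j * q.[z] ^+ n.+1.
    have -> : p.[z] = s * cos (j%:R * w) * q.[z] by rewrite -zj divfK.
    have [-> | ->] : s = 1 \/ s = -1.
      by move/eqP: s1; rewrite sqrf_eq1 => /orP[/eqP|/eqP]; [left|right].
      rewrite expr1n !mul1r cheb_cos -cos_natpi; congr (cos _ * _).
      by rewrite mulrCA wn.
    rewrite mulN1r -cosDpi cheb_cos; congr (_ * _).
    rewrite -exprD -cos_natpi natrD; congr cos.
    by rewrite mulrDr mulrCA wn; ring.
  have -> : g.[z] - s ^+ n.+1 * (-1) ^+ j * q.[z] ^+ n.+1
      = (g.[z] / q.[z] ^+ n.+1 - s ^+ n.+1 * (-1) ^+ j) * q.[z] ^+ n.+1.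
    by rewrite mulrBl divfK // expf_neq0.
  by rewrite normrM normrX gtr_pMl // exprn_gt0 // normr_gt0.
(* The induction carries the last alternation point [y], to the left of which all zeros counted so
   far lie. *)
suff H j : (j <= n.+1)%N -> exists2 y, a <= y <= b &
    p.[y] / q.[y] = s * cos (j%:R * w) /\ zeros_in g a y j.
  have [y /andP[_ yb] [_ Z]] := H n.+1 (leqnn _).
  by apply: zeros_in_sub Z.
elim: j => [|j IH] jn.
  exists a; rewrite ?lexx //; split; last by exists [::].
  by rewrite mul0r cos0 mulr1 pa mulfK // q0 ?lexx.
have [y /andP[ay yb] [yj Z]] := IH (ltnW jn).
have qyb z : y <= z <= b -> q.[z] != 0.
  by move=> /andP[yz zb]; rewrite q0 // zb (le_trans ay yz).
have jpi k : (k <= n.+1)%N -> (k%:R * w) \in `[0, (pi : R)].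
  move=> kn; rewrite in_itv /= mulr_ge0 ?(ltW wpos) //= -wn.
  by rewrite ler_pM2r // ler_nat.
(* The factor [s] normalizes the direction: [s p / q] is [cos (j w)] at [y] and [-1] at [b], and the
   next cosine lies between these. *)
have [|z /andP[yz zb]] := @IVT_decr R (s *: p) q y b (cos (j.+1%:R * w)) yb qyb.
  have -> : (s *: p).[y] / q.[y] = cos (j%:R * w).
    by rewrite hornerZ -mulrA yj mulrA -expr2 s1 mul1r.
  have -> : (s *: p).[b] / q.[b] = -1.
    by rewrite hornerZ pb mulrA mulrN -expr2 s1 mulfK // q0 // ab lexx.
  rewrite cos_geN1 /=.
  apply/ltW; rewrite ltr_cos ?jpi ?(ltnW jn) //.
  by rewrite ltr_pM2r // ltr_nat.
rewrite hornerZ => zj.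
have zjs : p.[z] / q.[z] = s * cos (j.+1%:R * w).
  by rewrite -zj !mulrA -expr2 s1 mul1r.
exists z; first by rewrite zb (le_trans ay yz).
split=> //; rewrite -addn1; apply: zeros_in_cat Z _ => //.
apply: (@zeros_in1 R g q y z n.+1) => //.
  by move=> x /andP[yx xz]; rewrite qyb // yx (le_trans xz zb).
apply: (@mul_near_signs_lt0 _ _ _ (s ^+ n.+1 * (-1) ^+ j)).
- by rewrite exprMn -!exprM [(n.+1 * 2)%N]mulnC [(j * 2)%N]mulnC !exprM s1 sqrrN
    !expr1n mulr1.
- by apply: close => //; rewrite ay.
- have /close : a <= z <= b by rewrite zb (le_trans ay yz).
  by move/(_ _ zjs); rewrite [(-1) ^+ j.+1]exprS mulN1r mulrN opprK.
Qed.

(** The comparison in abstract form, with [x = num / den] and [A = N / (den * cof)]. The hypothesis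
    on [g] packages the alternation on [F]; the point [z1], where [A = 1], excludes [g = 0]. *)
Lemma comparison (R : realType) (F E : set R) (num den cof N : {poly R}) d t z1 n
    (p : {poly R}) (M : R) :
  (size N <= d.+1)%N -> (size (num * cof)%R <= d.+1)%N ->
  (size (den * cof)%R <= d.+1)%N ->
  den.[t] = 0 -> (num * cof).[t] != 0 ->
  (forall z, F z -> (den * cof).[z] != 0 /\ E (num.[z] / den.[z])) ->
  F z1 -> N.[z1] = (den * cof).[z1] ->
  (forall g : {poly R},
    (forall z, F z -> `|g.[z] - (cheb N (den * cof) n.+1).[z]| < `|(den *
        cof).[z]| ^+ n.+1) ->
    exists rs, [/\ size rs = (n.+1 * d)%N, uniq rs, {in rs, forall z, F z} & all
        (root g) rs]) ->
  p \is monic -> size p = n.+2 -> (forall x, E x -> `|p.[x]| <= M) ->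
  `|(num * cof).[t]| ^+ n.+1 <= M * (2 ^+ n * `|N.[t]| ^+ n.+1).
Proof.
move=> sN sX sD dt xt FE Fz1 Nz1 zeros pm sp pM.
rewrite leNgt; apply/negP => small.
have xt0 : 0 < `|(num * cof).[t]| ^+ n.+1 by rewrite exprn_gt0 // normr_gt0.
(* The ratio of the values at [t] of the two terms of [g]; since [den] vanishes there, each value
   comes from a leading coefficient. *)
pose c := 2 ^+ n * N.[t] ^+ n.+1 / (num * cof).[t] ^+ n.+1.
have cM : `|c| * M < 1.
  rewrite /c normrM normfV normrM !normrX [`|2|]ger0_norm ?ler0n // mulrAC.
  by rewrite ltr_pdivrMr // mul1r mulrC.
pose g := cheb N (den * cof) n.+1 - c *: homog polyC p (num * cof) (den * cof) n.+1.
have gclose z : F z -> `|g.[z] - (cheb N (den * cof) n.+1).[z]| < `|(den *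
    cof).[z]| ^+ n.+1.
  move=> Fz; have [dz Ez] := FE z Fz.
  rewrite /g hornerD hornerN hornerZ addrAC subrr add0r normrN.
  rewrite horner_homog homog_div ?sp //.
  have -> : (num * cof).[z] / (den * cof).[z] = num.[z] / den.[z].
    have [d0 k0] : den.[z] != 0 /\ cof.[z] != 0.
      by move: dz; rewrite hornerM mulf_eq0 negb_or => /andP.
    by rewrite !hornerM invfM mulrACA mulfV // mulr1.
  rewrite mulrCA normrM normrX gtr_pMr ?exprn_gt0 ?normr_gt0 // normrM.
  by apply: le_lt_trans cM; rewrite ler_wpM2l // pM.
have [rs [srs urs Frs rootrs]] := zeros g gclose.
have gt0 : root g t.
  rewrite /root /g hornerD hornerN hornerZ horner_homog horner_cheb.
  rewrite [(den * cof).[t]]hornerM dt mul0r cheb_0r homog_0r.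
  have -> : p`_n.+1 = 1 by move/monicP: pm; rewrite lead_coefE sp.
  by rewrite mul1r /c divfK ?subrr // expf_neq0.
have trs : t \notin rs.
  apply/negP => /Frs /FE [].
  by rewrite hornerM dt mul0r eqxx.
(* If [g] were zero, then at [z1] the strict inequality [gclose] would compare
   [|den * cof| ^ (n + 1)] with itself. *)
have [g0|g0] := eqVneq g 0.
  have := gclose _ Fz1; rewrite g0 horner0 sub0r normrN horner_cheb Nz1.
  have := cheb_cos 0 (den * cof).[z1] n.+1.
  by rewrite mulr0 cos0 !mul1r => ->; rewrite normrX ltxx.
have sg : (size g <= (n.+1 * d).+1)%N.
  apply: size_add_deg; first exact: size_cheb.
  by rewrite size_polyN; apply: leq_trans (size_scale_leq _ _) _; apply: size_homog.
have := max_poly_roots (rs := t :: rs) g0; rewrite /= gt0 trs urs rootrs srs.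
by move=> /(_ isT isT); rewrite ltnNge sg.
Qed.

(** * The explicit covering *)

(* With [r] in the place of [2 m / (1 + m ^ 2)]: the substitution is
   [x = numx / denx] and the comparison function is [A = numA / (denx * cofA)].
   They are encoded by half phases: writing [x = cos phi], [A = cos theta],
   the numbers [cos (phi / 2)], [sin (phi / 2)] are proportional to
   [sqrt wpos * lpos], [sqrt wneg * lneg], and [cos (theta / 2)],
   [sin (theta / 2)] to [sqrt wpos * cubic (- t) (- z)],
   [sqrt wneg * cubic t z]. *)
Definition wpos (A : comPzRingType) (r t z : A) : A :=
  (2 * z + r * (1 + z ^+ 2)) * (r * (1 + t ^+ 2) - 2 * t).
Definition wneg (A : comPzRingType) (r t z : A) : A :=
  (2 * z - r * (1 + z ^+ 2)) * (r * (1 + t ^+ 2) + 2 * t).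
Definition lpos (A : comPzRingType) (t z : A) : A := (1 + z) * (1 - t).
Definition lneg (A : comPzRingType) (t z : A) : A := (1 - z) * (1 + t).
Definition cubic (A : comPzRingType) (r t z : A) : A :=
  let c := r * (1 + r - r ^+ 2) in
  let e := r * (r ^+ 2 + 2 * r - 2) in
  let f := 4 - r - 2 * r ^+ 2 in
  (- r + c * t + r ^+ 2 * t ^+ 2 - r ^+ 3 * t ^+ 3)
  + (- c + f * t + e * t ^+ 2 - r ^+ 2 * t ^+ 3) * z
  + (r ^+ 2 - e * t - f * t ^+ 2 + c * t ^+ 3) * z ^+ 2
  + (r ^+ 3 - r ^+ 2 * t - c * t ^+ 2 + r * t ^+ 3) * z ^+ 3.
Definition numx (A : comPzRingType) (r t z : A) : A :=
  wpos r t z * lpos t z ^+ 2 - wneg r t z * lneg t z ^+ 2.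
Definition denx (A : comPzRingType) (r t z : A) : A :=
  wpos r t z * lpos t z ^+ 2 + wneg r t z * lneg t z ^+ 2.
Definition numA (A : comPzRingType) (r t z : A) : A :=
  wpos r t z * cubic r (- t) (- z) ^+ 2 - wneg r t z * cubic r t z ^+ 2.
Definition cofA (A : comPzRingType) (r t z : A) : A :=
  r ^+ 2 * (1 - r) ^+ 2 * (1 + t * z) ^+ 4.
Definition qx (A : comPzRingType) (r t z : A) : A :=
  r * (1 + t ^+ 2) * (1 + z ^+ 2) - 4 * t * z.

(** The factorization exhibits the pole of [x] at [t] and reduces the sign of [denx] on the arcs to
    explicit factors. *)
Lemma denxE (R : comPzRingType) (r t z : R) :
  denx r t z = 4 * (1 + r) * (z - t) * (1 - t * z) * qx r t z.
Proof. rewrite /denx /wpos /wneg /lpos /lneg /qx; ring. Qed.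

(** A Pell-type identity expressing [cos ^ 2 + sin ^ 2 = 1] for the half phase [theta / 2]; [A] is
    [1] or [-1] where one of the two terms vanishes and the right side does not. *)
Lemma pell (R : comPzRingType) (r t z : R) :
  wpos r t z * cubic r (- t) (- z) ^+ 2 + wneg r t z * cubic r t z ^+ 2
  = denx r t z * cofA r t z.
Proof.
rewrite denxE /wpos /wneg /cubic /qx /cofA. ring.
Qed.

(* The real part of [e^(i theta / 2) = (e^(i kappa / 2))^2 * e^(i phi / 2)], where
   the linear forms [p], [n] give [cos (kappa / 2)], [sin (kappa / 2)]. *)
Lemma half_phase_factor (R : comPzRingType) (r t z : R) :
  let p := (r + t) * z - (1 + r * t) in let n := (r - t) * z + (1 - r * t) in
  (p ^+ 2 * wpos r t z - n ^+ 2 * wneg r t z) * lpos t z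
   - 2 * p * n * wneg r t z * lneg t z
  = - (4 * (1 + r) * (z - t) * (1 - t * z) * cubic r (- t) (- z)).
Proof.
rewrite /= /wpos /wneg /cubic /lpos /lneg. ring.
Qed.

(** Up to a common factor this is [sin ((theta - phi) / 2) = sin kappa], with [cos (theta / 2)]
    proportional to [- cubic (- t) (- z)] as in the preceding identity. *)
Lemma half_phase_quotient (R : comPzRingType) (r t z : R) :
  let p := (r + t) * z - (1 + r * t) in let n := (r - t) * z + (1 - r * t) in
  lpos t z * cubic r t z + lneg t z * cubic r (- t) (- z) = 2 * p * n * qx r t z.
Proof.
rewrite /= /qx /cubic /lpos /lneg. ring.
Qed.
(** Gives the value of [numA] at the pole [z = t], from which the constant of the lower bound is
    computed. *)
Lemma cubic_diag (R : comPzRingType) (r t : R) :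
  cubic r (- t) (- t) = (1 - t ^+ 2) * (4 * t ^+ 2 - r * (1 + t ^+ 2) ^+ 2).
Proof. rewrite /cubic; ring. Qed.

Lemma rmorph_cubic (A B : comPzRingType) (f : {rmorphism A -> B}) r t z :
  f (cubic r t z) = cubic (f r) (f t) (f z).
Proof.
by rewrite /cubic !(rmorphXn, rmorphB, rmorphD, rmorphN, rmorph_nat, rmorph1,
    rmorphM).
Qed.

Lemma rmorph_covering (A B : comPzRingType) (f : {rmorphism A -> B}) r t z :
  [/\ f (numx r t z) = numx (f r) (f t) (f z),
      f (denx r t z) = denx (f r) (f t) (f z),
      f (numA r t z) = numA (f r) (f t) (f z) &
      f (cofA r t z) = cofA (f r) (f t) (f z)].
Proof.
rewrite /numx /denx /numA /cofA /wpos /wneg /lpos /lneg.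
by split;
  rewrite !(rmorph_cubic, rmorphXn, rmorphB, rmorphD, rmorphN, rmorph_nat,
      rmorph1, rmorphM).
Qed.

Lemma horner_covering (R : comNzRingType) (r t z : R) :
  [/\ (numx r%:P t%:P 'X).[z] = numx r t z,
      (denx r%:P t%:P 'X).[z] = denx r t z,
      (numA r%:P t%:P 'X).[z] = numA r t z &
      (cofA r%:P t%:P 'X).[z] = cofA r t z].
Proof.
have := rmorph_covering (horner_eval z) r%:P t%:P 'X.
by rewrite /= !horner_evalE !hornerC hornerX.
Qed.

Lemma horner_cubic (R : comNzRingType) (r t z : R) :
  (cubic r%:P t%:P 'X).[z] = cubic r t z.
Proof.
have := rmorph_cubic (horner_eval z) r%:P t%:P 'X.
by rewrite /= !horner_evalE !hornerC hornerX.
Qed.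

(** Reflecting [z] and [t] together changes the signs of [x] and [A], so the analysis on [[m, 1/m]]
    also covers the negative arc. *)
Lemma coveringN (R : comPzRingType) (r t z : R) :
  [/\ numx r t (- z) = numx r (- t) z, denx r t (- z) = - denx r (- t) z,
      numA r t (- z) = numA r (- t) z & cofA r t (- z) = cofA r (- t) z].
Proof.
rewrite /numx /denx /numA /cofA /wpos /wneg /lpos /lneg !opprK !sqrrN !mulrN
    !mulNr !opprK.
by split=> //; ring.
Qed.

(** * Degrees of the covering polynomials *)

Lemma size_natr_deg (A : nzRingType) k d : (size (k%:R : {poly A}) <= d.+1)%N.
Proof. by rewrite -polyC_natr (leq_trans (size_polyC_leq1 _)). Qed.

Lemma size_polyC_deg (A : nzRingType) (c : A) d : (size c%:P <= d.+1)%N.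
Proof. exact: leq_trans (size_polyC_leq1 _) _. Qed.

Lemma size_opp_deg (A : nzRingType) (p : {poly A}) d :
  (size p <= d)%N -> (size (- p)%R <= d)%N.
Proof. by rewrite size_polyN. Qed.

Lemma size_covering (R : comNzRingType) (r t : R) :
  let N := numA r%:P t%:P 'X in let K := cofA r%:P t%:P 'X in
  [/\ (size N <= 9)%N, (size (numx r%:P t%:P 'X * K)%R <= 9)%N &
      (size (denx r%:P t%:P 'X * K)%R <= 9)%N].
Proof.
have X1 : (size ('X : {poly R})%R <= 2)%N by rewrite size_polyX.
have [p0 p1] : (size (r%:P * (1 + t%:P ^+ 2) - 2 * t%:P : {poly R})%R <= 1)%N
            /\ (size (r%:P * (1 + t%:P ^+ 2) + 2 * t%:P : {poly R})%R <= 1)%N.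
  rewrite -!polyC_natr -polyC1 -!polyC_exp -!polyCD -!polyCM -polyCB -polyCD.
  by rewrite !size_polyC_leq1.
have X2 : (size ('X ^+ 2 : {poly R})%R <= 3)%N by rewrite size_polyXn.
have s2 : (size (r%:P * (1 + 'X ^+ 2) : {poly R})%R <= 3)%N.
  apply: (@size_mul_deg _ _ _ 0 2); first exact: size_polyC_deg.
  by apply: size_add_deg => //; rewrite size_poly1.
have s3 : (size (2 * 'X : {poly R})%R <= 3)%N.
  by apply: (@size_mul_deg _ _ _ 1 1); rewrite ?size_natr_deg.
have sP : (size (wpos r%:P t%:P 'X) <= 3)%N.
  by apply: (@size_mul_deg _ _ _ 2 0) => //; apply: size_add_deg.
have sN : (size (wneg r%:P t%:P 'X) <= 3)%N.
  by apply: (@size_mul_deg _ _ _ 2 0) => //; apply: size_add_deg => //; apply: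
      size_opp_deg.
have sl : (size (lpos t%:P 'X) <= 2)%N.
  apply: (@size_mul_deg _ _ _ 1 0); first by apply: size_add_deg => //; rewrite
      size_poly1.
  by rewrite -polyC1 -polyCB size_polyC_leq1.
have sm : (size (lneg t%:P 'X) <= 2)%N.
  apply: (@size_mul_deg _ _ _ 1 0).
    by apply: size_add_deg => //; [rewrite size_poly1|apply: size_opp_deg].
  by rewrite -polyC1 -polyCD size_polyC_leq1.
have sc s (x : {poly R}) : (size x <= 2)%N -> (size (cubic r%:P s%:P x) <= 4)%N.
  move=> hx; rewrite /cubic -!polyC_natr -polyC1.
  do ?rewrite -?polyCM -?polyCD -?polyCB -?polyC_exp -?polyCN.
  do 3 ?apply: size_add_deg; first exact: size_polyC_deg.
  - by apply: (@size_mul_deg _ _ _ 2 1) => //; apply: size_polyC_deg.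
  - apply: (@size_mul_deg _ _ _ 1 2); first exact: size_polyC_deg.
    exact: (@size_exp_deg _ _ 1 2).
  - apply: (@size_mul_deg _ _ _ 0 3); first exact: size_polyC_deg.
    exact: (@size_exp_deg _ _ 1 3).
have sK : (size (cofA r%:P t%:P 'X) <= 5)%N.
  rewrite /cofA; apply: (@size_mul_deg _ _ _ 0 4).
    by rewrite -polyC1 -polyCB -!polyC_exp -polyCM size_polyC_leq1.
  apply: (@size_exp_deg _ _ 1 4); apply: size_add_deg; first by rewrite size_poly1.
  by apply: (@size_mul_deg _ _ _ 0 1); rewrite ?size_polyC_deg.
have sl2 := size_exp_deg 2 sl; have sm2 := size_exp_deg 2 sm.
have sPl := size_mul_deg sP sl2; have sNm := size_mul_deg sN sm2.
have sX : (size (- 'X : {poly R})%R <= 2)%N by apply: size_opp_deg.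
split.
- rewrite /numA -polyCN; apply: size_add_deg.
    exact: (size_mul_deg sP (size_exp_deg 2 (sc _ _ sX))).
  by apply/size_opp_deg/(size_mul_deg sN (size_exp_deg 2 (sc _ _ X1))).
- by apply: (@size_mul_deg _ _ _ 4 4) => //; apply: size_add_deg => //; apply:
    size_opp_deg.
- by apply: (@size_mul_deg _ _ _ 4 4) => //; apply: size_add_deg.
Qed.

(** * Signs and alternation points on the arcs *)

Lemma poly_root_between (R : realType) (g : {poly R}) (a b : R) :
  a <= b -> g.[a] * g.[b] < 0 -> exists2 z, a < z < b & g.[z] = 0.
Proof.
move=> ab sgn.
have [rs [srs _ ars rrs]] : zeros_in g a b 1.
  apply: (@zeros_in1 R g 1 a b 0) => // [z _|]; first by rewrite hornerE oner_neq0.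
  by rewrite !expr0 !divr1.
case: rs srs ars rrs => [|z []] //= _ /andP[zab _] /andP[/rootP gz _].
by exists z.
Qed.

Lemma addr_1_sqr_gt0 (R : realDomainType) (x : R) : 0 < 1 + x ^+ 2.
Proof. by rewrite ltr_pwDl ?ltr01 ?sqr_ge0. Qed.

Lemma mul_near0_lt1 (R : realFieldType) (m t z : R) :
  - m < t < m -> 0 < z -> m * z <= 1 -> 0 < 1 - t * z /\ 0 < 1 + t * z.
Proof.
move=> /andP[mt tm] z0 mz; have tz : t * z < m * z by rewrite ltr_pM2r.
have : - m * z < t * z by rewrite ltr_pM2r.
by rewrite mulNr => mtz; split; lra.
Qed.

(** Multiplied by [1 + m ^ 2], the two weights factor as [2 (m - t) (1 - t m)] and
    [2 (m + t) (1 + t m)]. *)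
Lemma weights_gt0 (R : realFieldType) (r m t : R) :
  r * (1 + m ^+ 2) = 2 * m -> 0 < m < 1 -> - m < t < m ->
  0 < r * (1 + t ^+ 2) - 2 * t /\ 0 < r * (1 + t ^+ 2) + 2 * t.
Proof.
move=> rm /andP[m0 m1] tm.
have [mt1 mt2] : 0 < 1 - t * m /\ 0 < 1 + t * m.
  by apply: (mul_near0_lt1 tm) => //; rewrite mulr_ile1 // ltW.
have /andP[t0 t1] := tm.
split; rewrite -(pmulr_lgt0 _ (addr_1_sqr_gt0 m)).
  rewrite [ltRHS](_ : _ = 2 * ((m - t) * (1 - t * m))).
    by rewrite mulr_gt0 // mulr_gt0 // subr_gt0.
  by rewrite mulrBl mulrAC rm; ring.
rewrite [ltRHS](_ : _ = 2 * ((m + t) * (1 + t * m))).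
  by rewrite mulr_gt0 // mulr_gt0 //; lra.
by rewrite mulrDl mulrAC rm; ring.
Qed.

Lemma arc_signs (R : realFieldType) (r m t z : R) :
  r * (1 + m ^+ 2) = 2 * m -> 0 < r < 1 -> 0 < m < 1 -> - m < t < m -> m <= z <=
      m^-1 ->
  [/\ 0 < wpos r t z, 0 <= wneg r t z, 0 < (z - t) * (1 - t * z),
      0 < denx r t z /\ 0 < cofA r t z & 0 < qx r t z].
Proof.
move=> rm /andP[r0 r1] m01 tm /andP[z0 z1]; have /andP[m0 m1] := m01; have
    /andP[t0 t1] := tm.
have [u0 v0] := weights_gt0 rm m01 tm.
have zpos : 0 < z := lt_le_trans m0 z0.
have mz : m * z <= 1 by rewrite -(mulfV (lt0r_neq0 m0)) ler_pM2l.
have [tz1 tz2] := mul_near0_lt1 tm zpos mz.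
have zt : 0 < (z - t) * (1 - t * z) by rewrite mulr_gt0 // subr_gt0 (lt_le_trans
    t1).
have q0 : 0 < qx r t z.
  rewrite (_ : qx r t z = (r * (1 + t ^+ 2) - 2 * t) * (2 * z)
                        + r * (1 + t ^+ 2) * (1 - z) ^+ 2); last by rewrite /qx;
                            ring.
  by rewrite ltr_pwDl ?mulr_gt0 // mulr_ge0 ?sqr_ge0 // mulr_ge0 ?(ltW r0) // ltW
      ?addr_1_sqr_gt0.
split=> //.
- by rewrite mulr_gt0 // ltr_pwDl ?mulr_gt0 // mulr_ge0 ?(ltW r0) // ltW
    ?addr_1_sqr_gt0.
- rewrite mulr_ge0 ?(ltW v0) // -(pmulr_lge0 _ (addr_1_sqr_gt0 m)).
  rewrite [leRHS](_ : _ = 2 * ((z - m) * (1 - m * z))).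
    by rewrite mulr_ge0 // mulr_ge0 // subr_ge0.
  by rewrite mulrBl [r * _ * _]mulrAC rm; ring.
- split; last by rewrite /cofA !mulr_gt0 ?exprn_gt0 ?subr_gt0.
  by rewrite denxE mulr_gt0 // -mulrA mulr_gt0 // mulr_gt0 // ltr_wpDr // ltW.
Qed.

Lemma horner_cubicN (R : comNzRingType) (r t z : R) :
  (cubic r%:P t%:P (- 'X)).[z] = cubic r t (- z).
Proof.
have := rmorph_cubic (horner_eval z) r%:P t%:P (- 'X).
by rewrite /= !horner_evalE !hornerC hornerN hornerX.
Qed.

Lemma wneg_end (R : fieldType) (r m t : R) : m != 0 ->
  r * (1 + m ^+ 2) = 2 * m -> wneg r t m = 0 /\ wneg r t m^-1 = 0.
Proof.
move=> m0 rm; rewrite /wneg rm subrr mul0r; split=> //.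
rewrite (_ : 2 * m^-1 - _ = (2 * m - r * (1 + m ^+ 2)) / m ^+ 2); last by field.
by rewrite rm subrr !mul0r.
Qed.

(* On the arc [p] changes sign once, at [z0], while [n > 0]; by the half-phase
   identities [cubic (- t) (- z)] is negative at the ends and positive at [z0],
   and [cubic t z] has the sign of [z - z0] at the zeros of the former. *)
Lemma interlace (R : realType) (r m t : R) :
  r * (1 + m ^+ 2) = 2 * m -> 0 < r < 1 -> 0 < m < 1 -> - m < t < m ->
  exists z1 z2 z3, [/\ m < z1 < z2, z2 < z3 < m^-1,
    cubic r (- t) (- z1) = 0, cubic r t z2 = 0 & cubic r (- t) (- z3) = 0].
Proof.
move=> rm r01 m01 tm.
have signs z := @arc_signs R r m t z rm r01 m01 tm.
have /andP[r0 r1] := r01; have /andP[m0 m1] := m01; have /andP[t0 t1] := tm.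
have mr1 : 0 < 1 - m * r by rewrite subr_gt0 mulr_ilt1 // ltW.
have mrE : r - m = m * (1 - m * r) by lra.
have mr : m < r by rewrite -subr_gt0 mrE mulr_gt0.
have t11 : 0 < 1 - t by lra.
have rt0 : 0 < r + t by lra.
have rt1 : 0 < r - t by lra.
have [rt2 rt3] : 0 < 1 - t * r /\ 0 < 1 + t * r.
  by apply: (mul_near0_lt1 tm) => //; rewrite -subr_ge0; apply: ltW.
pose p z := (r + t) * z - (1 + r * t); pose n z := (r - t) * z + (1 - r * t).
pose z0 := (1 + r * t) / (r + t).
have pz z : p z = (r + t) * (z - z0) by rewrite /p /z0; field; rewrite gt_eqF.
have mz0 : m < z0.
  rewrite /z0 ltr_pdivlMr // -subr_gt0.
  rewrite [ltRHS](_ : _ = (1 - m) * (r + t) + (1 - r) * (1 - t)); last by ring.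
  by rewrite ltr_pwDl ?mulr_ge0 ?mulr_gt0 // ?subr_gt0 // ltW // subr_gt0.
have z0m : z0 < m^-1.
  rewrite /z0 ltr_pdivrMr // [m^-1 * _]mulrC ltr_pdivlMr // -subr_gt0.
  rewrite [ltRHS](_ : _ = (r - m) + t * (1 - m * r)); last by ring.
  by rewrite mrE -mulrDl mulr_gt0 //; lra.
have mm : m < m^-1 := lt_trans mz0 z0m.
have nz (z : R) : 0 < z -> 0 < n z.
  by move=> z_gt0; rewrite /n addr_gt0 ?mulr_gt0 // mulrC.
have lz (z : R) : 0 < z -> 0 < lpos t z by move=> z_gt0; rewrite /lpos mulr_gt0
    // addr_gt0.
pose c z := cubic r (- t) (- z).
have cz z : m <= z <= m^-1 ->
    exists2 k : R, 0 < k & - k * c z = (p z ^+ 2 * wpos r t z - n z ^+ 2 * wneg r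
        t z) * lpos t z
       - 2 * p z * n z * wneg r t z * lneg t z.
  move=> zm; have [_ _ zt _ _] := signs z zm.
  exists (4 * (1 + r) * ((z - t) * (1 - t * z))).
    by rewrite mulr_gt0 // mulr_gt0 // addr_gt0.
  by rewrite half_phase_factor /c; ring.
have [wm wm'] := wneg_end t (lt0r_neq0 m0) rm.
have c_end z : m <= z <= m^-1 -> wneg r t z = 0 -> z != z0 -> c z < 0.
  move=> zm w0 zz0; have [k k0] := cz z zm; have [wz _ _ _ _] := signs z zm.
  have z_gt0 : 0 < z by case/andP: zm => /(lt_le_trans m0).
  rewrite w0 !mulr0 mul0r !subr0 => kE; rewrite -(pmulr_rlt0 _ k0) -oppr_gt0
      -mulNr kE.
  have p0 : p z != 0 by rewrite pz mulf_neq0 ?subr_eq0 // gt_eqF.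
  by apply: mulr_gt0 (lz _ z_gt0); apply: mulr_gt0 wz; rewrite exprn_even_gt0.
have cm : c m < 0 by apply: c_end; rewrite ?lexx ?(ltW mm) // lt_eqF.
have cm' : c m^-1 < 0 by apply: c_end; rewrite ?lexx ?(ltW mm) // gt_eqF.
have z00 : 0 < z0 := lt_trans m0 mz0.
(* As [p] vanishes at [z0], the half-phase identity leaves only the term with [- n ^ 2 * wneg], and
   [wneg] is positive inside the arc. *)
have cz0 : 0 < c z0.
  have z0in : m <= z0 <= m^-1 by rewrite !ltW.
  have [k k0] := cz z0 z0in.
  have -> : p z0 = 0 by rewrite pz subrr mulr0.
  rewrite expr0n mul0r sub0r mulr0 !mul0r subr0 => kE.
  rewrite -(pmulr_rgt0 _ k0) -oppr_lt0 -mulNr kE mulNr oppr_lt0.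
  rewrite mulr_gt0 ?lz // mulr_gt0 ?exprn_gt0 ?nz //.
  rewrite /wneg mulr_gt0 ?(weights_gt0 rm m01 tm).2 // -(pmulr_lgt0 _
      (addr_1_sqr_gt0 m)).
  rewrite [ltRHS](_ : _ = 2 * ((z0 - m) * (1 - m * z0))).
    rewrite mulr_gt0 // mulr_gt0 // subr_gt0 //.
    by rewrite -(mulfV (lt0r_neq0 m0)) ltr_pM2l.
  by rewrite mulrBl [r * _ * _]mulrAC rm; ring.
pose C := cubic r%:P (- t)%:P (- 'X).
have CE z : C.[z] = c z by rewrite horner_cubicN.
have [z1 /andP[mz1 z10] cz1] : exists2 z, m < z < z0 & C.[z] = 0.
  by apply: poly_root_between; rewrite ?(ltW mz0) // !CE nmulr_rlt0.
have [z3 /andP[z03 z3m] cz3] : exists2 z, z0 < z < m^-1 & C.[z] = 0.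
  by apply: poly_root_between; rewrite ?(ltW z0m) // !CE pmulr_rlt0.
have cubE z : m <= z <= m^-1 -> c z = 0 ->
    exists2 k : R, 0 < k & lpos t z * cubic r t z = k * (z - z0).
  move=> zm c0; have [_ _ _ _ qz] := signs z zm.
  have z_gt0 : 0 < z by case/andP: zm => /(lt_le_trans m0).
  exists (2 * (r + t) * n z * qx r t z); first by rewrite !mulr_gt0 ?nz.
  have := half_phase_quotient r t z; rewrite /= -/(c z) c0 mulr0 addr0 => ->.
  by rewrite -/(p z) -/(n z) pz; ring.
have z13 : z1 < z3 := lt_trans z10 z03.
have z1in : m <= z1 <= m^-1 by rewrite (ltW mz1) ltW // (lt_trans z13).
have z3in : m <= z3 <= m^-1 by rewrite (ltW z3m) ltW // (lt_trans mz1).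
have [z2 /andP[z12 z23] cz2] : exists2 z, z1 < z < z3 & (cubic r%:P t%:P 'X).[z]
    = 0.
  apply: poly_root_between; first exact: ltW.
  rewrite !horner_cubic.
  have [k k0 kE] := cubE z1 z1in (etrans (esym (CE _)) cz1).
  have [k' k'0 kE'] := cubE z3 z3in (etrans (esym (CE _)) cz3).
  have z1_gt0 : 0 < z1 := lt_trans m0 mz1.
  have z3_gt0 : 0 < z3 := lt_trans z1_gt0 z13.
  rewrite -(pmulr_rlt0 _ (mulr_gt0 (lz _ z1_gt0) (lz _ z3_gt0))) mulrACA kE kE'.
  by rewrite nmulr_rlt0 ?pmulr_rgt0 ?subr_gt0 // pmulr_rlt0 // subr_lt0.
exists z1, z2, z3; split; rewrite ?mz1 ?z12 ?z23 ?z3m //.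
- by rewrite -cz1 CE.
- by rewrite -cz2 horner_cubic.
- by rewrite -cz3 CE.
Qed.

(** Each of the four runs of [N / D] between [s] and [- s] contributes [n] zeros by alternation. *)
Lemma arcs4_zeros (R : realType) (g N D : {poly R}) (s w0 w1 w2 w3 w4 : R) n :
  [/\ w0 <= w1, w1 <= w2, w2 <= w3 & w3 <= w4] -> s ^+ 2 = 1 ->
  (forall z, w0 <= z <= w4 -> D.[z] != 0) ->
  [/\ N.[w0] = s * D.[w0], N.[w1] = - s * D.[w1], N.[w2] = s * D.[w2],
      N.[w3] = - s * D.[w3] & N.[w4] = s * D.[w4]] ->
  (forall z, w0 <= z <= w4 -> `|g.[z] - (cheb N D n).[z]| < `|D.[z]| ^+ n) ->
  zeros_in g w0 w4 (n * 4).
Proof.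
move=> [l01 l12 l23 l34] s1 D0 [e0 e1 e2 e3 e4] gN.
have l02 := le_trans l01 l12; have l03 := le_trans l02 l23.
have l24 := le_trans l23 l34; have l14 := le_trans l12 l24.
have arc a b u : w0 <= a -> a <= b -> b <= w4 -> u ^+ 2 = 1 ->
    N.[a] = u * D.[a] -> N.[b] = - u * D.[b] -> zeros_in g a b n.
  move=> la ab lb u1 ea eb; apply: (arc_zeros ab u1 _ ea eb) => z /andP[az zb].
    by apply: D0; rewrite (le_trans la az) (le_trans zb lb).
  by apply: gN; rewrite (le_trans la az) (le_trans zb lb).
have s1' : (- s) ^+ 2 = 1 by rewrite sqrrN.
rewrite (_ : (n * 4 = n + (n + (n + n)))%N); last by rewrite !mulnS muln0 addn0.
apply: (zeros_in_cat l01 l14); first exact: (arc _ _ s).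
apply: (zeros_in_cat l12 l24); first by apply: (arc _ _ (- s)); rewrite ?opprK.
apply: (zeros_in_cat l23 l34); first exact: (arc _ _ s).
by apply: (arc _ _ (- s)); rewrite ?opprK.
Qed.

(** The upper bound is the nonnegativity of [wneg]. For the lower one, the equation for [b] makes
    [numx - b * denx] a nonnegative multiple of the square of [s (1 + z ^ 2) - 2 z]: [b] is a double
    value of [x]. *)
Lemma arc_image (R : realFieldType) (r m t s b z : R) :
  r * (1 + m ^+ 2) = 2 * m -> 0 < r < 1 -> 0 < m < 1 -> - m < t < m ->
  0 < s < 1 -> s ^+ 2 = r -> b < 1 ->
  (1 + b) * ((1 + t) ^+ 2 * (r * (1 + t ^+ 2) + 2 * t) * (1 - s) ^+ 2)
    = (1 - b) * ((1 - t) ^+ 2 * (r * (1 + t ^+ 2) - 2 * t) * (1 + s) ^+ 2) ->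
  m <= z <= m^-1 -> b <= numx r t z / denx r t z <= 1.
Proof.
move=> rm r01 m01 tm /andP[s0 s1] sr b1 bE zm.
have [w0 v0 zt [d0 _] _] := arc_signs rm r01 m01 tm zm.
have [u0 _] := weights_gt0 rm m01 tm.
rewrite ler_pdivlMr // ler_pdivrMr // mul1r; apply/andP; split; last first.
  have vl : 0 <= wneg r t z * lneg t z ^+ 2 by rewrite mulr_ge0 ?sqr_ge0.
  by rewrite /numx /denx; lra.
rewrite -subr_ge0 [leRHS](_ : _ = (1 - b) * (wpos r t z * lpos t z ^+ 2)
    - (1 + b) * (wneg r t z * lneg t z ^+ 2)); last by rewrite /numx /denx; ring.
have s2 : 0 < (1 - s) ^+ 2 by rewrite exprn_gt0 // subr_gt0.
rewrite -(pmulr_lge0 _ s2).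
rewrite [leRHS](_ : _ = (1 - b) * (1 - t) ^+ 2 * (r * (1 + t ^+ 2) - 2 * t)
   * ((2 * z + r * (1 + z ^+ 2)) * (1 + z) ^+ 2 * (1 - s) ^+ 2)
   - (1 + b) * ((1 + t) ^+ 2 * (r * (1 + t ^+ 2) + 2 * t) * (1 - s) ^+ 2)
   * ((2 * z - r * (1 + z ^+ 2)) * (1 - z) ^+ 2)); last by rewrite /wpos /wneg
       /lpos /lneg; ring.
rewrite bE [leRHS](_ : _ = (1 - b) * (1 - t) ^+ 2 * (r * (1 + t ^+ 2) - 2 * t)
   * (2 * (1 + s ^+ 2) * (s * (1 + z ^+ 2) - 2 * z) ^+ 2)); last first.
  by rewrite -sr; ring.
apply: mulr_ge0.
  by rewrite mulr_ge0 ?(ltW u0) // mulr_ge0 ?sqr_ge0 // subr_ge0 ltW.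
by rewrite mulr_ge0 ?sqr_ge0 // mulr_ge0 // ltW ?addr_1_sqr_gt0.
Qed.

(** Here and in the next two lemmas one term of the Pell identity drops out, which locates the
    values [1] and [-1] of [A]. *)
Lemma numA_end (R : comNzRingType) (r t z : R) :
  wneg r t z = 0 -> numA r t z = denx r t z * cofA r t z.
Proof. by rewrite -pell /numA => ->; rewrite !mul0r subr0 addr0. Qed.

Lemma numA_max (R : comNzRingType) (r t z : R) :
  cubic r t z = 0 -> numA r t z = denx r t z * cofA r t z.
Proof. by rewrite -pell /numA => ->; rewrite expr0n mulr0 subr0 addr0. Qed.

Lemma numA_min (R : comNzRingType) (r t z : R) :
  cubic r (- t) (- z) = 0 -> numA r t z = - (denx r t z * cofA r t z).
Proof. by rewrite -pell /numA => ->; rewrite expr0n mulr0 sub0r add0r. Qed.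

(** The two equations are the condition of [arc_image] for [beta] and, after reflection, for
    [- alpha]. The base [k ^ 2 / 2] is the limit of [x / A] at the common pole [t], halved because
    of the leading coefficient of the Chebyshev polynomial. *)
Lemma two_intervals_lower (R : realType) (r m t s alpha beta M : R) (p : {poly
    R}) n :
  r * (1 + m ^+ 2) = 2 * m -> 0 < r < 1 -> 0 < m < 1 -> - m < t < m ->
  0 < s < 1 -> s ^+ 2 = r -> -1 < alpha -> beta < 1 ->
  (1 + beta) * ((1 + t) ^+ 2 * (r * (1 + t ^+ 2) + 2 * t) * (1 - s) ^+ 2)
    = (1 - beta) * ((1 - t) ^+ 2 * (r * (1 + t ^+ 2) - 2 * t) * (1 + s) ^+ 2) ->
  (1 - alpha) * ((1 - t) ^+ 2 * (r * (1 + t ^+ 2) - 2 * t) * (1 - s) ^+ 2)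
    = (1 + alpha) * ((1 + t) ^+ 2 * (r * (1 + t ^+ 2) + 2 * t) * (1 + s) ^+ 2) ->
  p \is monic -> size p = n.+2 ->
  (forall x, two_intervals alpha beta x -> `|p.[x]| <= M) ->
  2 * ((r * (1 - r) * (1 + t ^+ 2) ^+ 2 / (r * (1 + t ^+ 2) ^+ 2 - 4 * t ^+ 2))
      ^+ 2 / 2) ^+ n.+1
    <= M.
Proof.
move=> rm r01 m01 tm s01 sr a1 b1 bE aE pm sp pM.
have tm' : - m < - t < m by rewrite ltrN2 ltrNl andbC.
have /andP[r0 r1] := r01; have /andP[m0 m1] := m01; have /andP[t0 t1] := tm.
pose F : set R := [set z | m <= z <= m^-1 \/ m <= - z <= m^-1].
pose N := numA r%:P t%:P 'X; pose K := cofA r%:P t%:P 'X.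
pose X := numx r%:P t%:P 'X; pose Y := denx r%:P t%:P 'X.
have XE z : X.[z] = numx r t z by have [] := horner_covering r t z.
have YE z : Y.[z] = denx r t z by have [] := horner_covering r t z.
have NE z : N.[z] = numA r t z by have [] := horner_covering r t z.
have KE z : K.[z] = cofA r t z by have [] := horner_covering r t z.
have YKE z : (Y * K).[z] = denx r t z * cofA r t z by rewrite hornerM YE KE.
have XN z : numx r t (- z) = numx r (- t) z by have [] := coveringN r t z.
have YN z : denx r t (- z) = - denx r (- t) z by have [] := coveringN r t z.
have NN z : numA r t (- z) = numA r (- t) z by have [] := coveringN r t z.
have KN z : cofA r t (- z) = cofA r (- t) z by have [] := coveringN r t z.
have [sN sX sY] := size_covering r t.
have D0 z : F z -> (Y * K).[z] != 0.
  rewrite YKE => -[] zm.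
    by have [_ _ _ [d k] _] := arc_signs rm r01 m01 tm zm; rewrite mulf_neq0
        ?gt_eqF.
  have [_ _ _ [d k] _] := arc_signs rm r01 m01 tm' zm.
  by rewrite -[z]opprK YN KN mulf_neq0 ?oppr_eq0 ?gt_eqF.
have FE z : F z -> (Y * K).[z] != 0 /\ two_intervals alpha beta (X.[z] / Y.[z]).
  move=> Fz; split; first exact: D0.
  rewrite XE YE; case: Fz => zm.
    right; rewrite /= in_itv /=.
    exact: arc_image rm r01 m01 tm s01 sr b1 bE zm.
  left; rewrite /= in_itv /= -[z]opprK XN YN invrN mulrN.
  rewrite lerN2 lerNl andbC.
  apply: (arc_image rm r01 m01 tm' s01 sr _ _ zm); first by rewrite ltrNl.
  by rewrite sqrrN !opprK !mulrN !opprK.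
have zeros (g : {poly R}) :
    (forall z, F z -> `|g.[z] - (cheb N (Y * K) n.+1).[z]| < `|(Y * K).[z]| ^+
        n.+1) ->
    exists rs, [/\ size rs = (n.+1 * 8)%N, uniq rs, {in rs, forall z, F z} & all
        (root g) rs].
  move=> gF.
  have m_neq0 := lt0r_neq0 m0.
  have [z1 [z2 [z3 [/andP[mz1 z12] /andP[z23 z3m] c1 c2 c3]]]] := interlace rm
      r01 m01 tm.
  have [y1 [y2 [y3 [/andP[my1 y12] /andP[y23 y3m] d1 d2 d3]]]] := interlace rm
      r01 m01 tm'.
  have mm : m < m^-1 by rewrite (lt_trans mz1) // (lt_trans z12) // (lt_trans z23).
  have [e1 e2] := wneg_end t m_neq0 rm; have [f1 f2] := wneg_end (- t) m_neq0 rm.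
  have [rs [srs urs Irs Rrs]] : zeros_in g m m^-1 (n.+1 * 4).
    apply: (@arcs4_zeros _ g N (Y * K) 1 m z1 z2 z3) => //.
    - by rewrite !ltW.
    - by rewrite expr1n.
    - by move=> z zm; apply: D0; left.
    - rewrite !YKE !mul1r !mulN1r !NE.
      by split; [exact: numA_end|exact: numA_min|exact: numA_max|exact:
          numA_min|exact: numA_end].
    - by move=> z zm; apply: gF; left.
  have [ps [sps ups Ips Rps]] : zeros_in g (- m^-1) (- m) (n.+1 * 4).
    (* Reflection changes the sign of [A], so the runs start at [-1], and it reverses the order of
       the alternation points. *)
    apply: (@arcs4_zeros _ g N (Y * K) (-1) _ (- y3) (- y2) (- y1)).
    - by rewrite !lerN2 !ltW.
    - by rewrite sqrrN expr1n.
    - by move=> z zm; apply: D0; right; rewrite lerNr lerNl andbC.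
    - rewrite !YKE !opprK !mul1r !mulN1r !NE !NN !YN !KN !mulNr !opprK.
      by split; [exact: numA_end|exact: numA_min|exact: numA_max|exact:
          numA_min|exact: numA_end].
    - by move=> z zm; apply: gF; right; rewrite lerNr lerNl andbC.
  exists (rs ++ ps); split.
  - by rewrite size_cat srs sps -mulnDr.
  - rewrite cat_uniq urs ups andbT /=; apply/hasPn => z zp; apply/negP => zr.
    have /andP[_ zm] := allP Ips _ zp; have /andP[mz _] := allP Irs _ zr.
    by have := lt_trans mz zm; rewrite ltNge; lra.
  - move=> z; rewrite mem_cat => /orP[/(allP Irs)|/(allP Ips)] /andP[az zb].
      by left; rewrite !ltW.
    by right; rewrite lerNr lerNl !ltW.
  - by rewrite all_cat Rrs.
have [u0 v0] := weights_gt0 rm m01 tm.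
have Yt : Y.[t] = 0 by rewrite YE denxE subrr mulr0 !mul0r.
have t21 : 0 < 1 - t ^+ 2.
  have -> : 1 - t ^+ 2 = (1 - t) * (1 + t) by ring.
  by rewrite mulr_gt0 //; lra.
have wt : 0 < wpos r t t by rewrite mulr_gt0 // addrC.
have k0 : 0 < r * (1 + t ^+ 2) ^+ 2 - 4 * t ^+ 2.
  have uv := mulr_gt0 u0 v0.
  have : 0 <= r * (1 - r) * (1 + t ^+ 2) ^+ 2.
    by rewrite mulr_ge0 ?sqr_ge0 // mulr_ge0 // ltW // subr_gt0.
  lra.
set k := r * (1 - r) * _ / _.
pose c := (1 - t ^+ 2) * (4 * t ^+ 2 - r * (1 + t ^+ 2) ^+ 2).
(* Since [denx] vanishes at [t], the two terms of the Pell identity are opposite there and [numA] is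
   twice the first; the same argument applies to [numx] below. *)
have NtE : N.[t] = 2 * (wpos r t t * c ^+ 2).
  have := pell r t t; rewrite -[denx r t t]YE Yt mul0r cubic_diag NE /numA
      cubic_diag -/c.
  lra.
have NX : (X * K).[t] = k ^+ 2 * N.[t].
  rewrite hornerM XE KE NtE.
  have -> : numx r t t = 2 * (wpos r t t * lpos t t ^+ 2).
    by have := Yt; rewrite YE /numx /denx; lra.
  rewrite /cofA /lpos /k /c; field.
  by rewrite gt_eqF.
have Nt : N.[t] != 0.
  rewrite NtE mulf_neq0 ?pnatr_eq0 // mulf_neq0 ?(gt_eqF wt) // expf_neq0 //.
  by rewrite /c mulf_neq0 ?(gt_eqF t21) // -oppr_eq0 opprB (gt_eqF k0).
have k_neq0 : k != 0.
  rewrite /k !mulf_neq0 ?invr_neq0 ?(gt_eqF k0) ?(gt_eqF r0) //.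
    by rewrite subr_eq0 gt_eqF.
  1,2: exact: lt0r_neq0 (addr_1_sqr_gt0 t).
have NXt : (X * K).[t] != 0 by rewrite NX mulf_neq0 // expf_neq0.
have mm : m <= m <= m^-1.
  by rewrite lexx /= (le_trans (ltW m1)) // invf_ge1 // ltW.
have Nm : N.[m] = (Y * K).[m].
  by rewrite NE YKE numA_end // (wneg_end t (lt0r_neq0 m0) rm).1.
have := @comparison R F (two_intervals alpha beta) X Y K N 8 t m n p M
  sN sX sY Yt NXt FE (or_introl mm) Nm zeros pm sp pM.
rewrite NX normrM [`|k ^+ 2|]ger0_norm ?sqr_ge0 // exprMn mulrA.
rewrite ler_pM2r ?exprn_gt0 ?normr_gt0 // => kM.
have -> : 2 * (k ^+ 2 / 2) ^+ n.+1 = (k ^+ 2) ^+ n.+1 / 2 ^+ n.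
  by rewrite expr_div_n [2 ^+ n.+1]exprS; field; rewrite expf_neq0 ?pnatr_eq0.
by rewrite ler_pdivrMr ?exprn_gt0.
Qed.

(** * Parameters of the covering in terms of the end points *)

Lemma half_angle (R : realType) (y : R) : -1 < y < 1 ->
  exists x, [/\ -1 < x < 1, y * (1 + x ^+ 2) = 2 * x & 0 < y -> 0 < x].
Proof.
move=> /andP[y0 y1]; pose w := Num.sqrt (1 - y ^+ 2).
have w2 : w ^+ 2 = 1 - y ^+ 2.
  rewrite sqr_sqrtr // (_ : 1 - y ^+ 2 = (1 - y) * (1 + y)); last by ring.
  by rewrite mulr_ge0 //; lra.
have w0 : 0 <= w := sqrtr_ge0 _.
have w1 : 0 < 1 + w by rewrite ltr_wpDr.
(* The root of smaller modulus of [y x ^ 2 - 2 x + y], in a form that allows [y = 0]. *)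
exists (y / (1 + w)); split.
- by rewrite ltr_pdivlMr // ltr_pdivrMr //; apply/andP; split; lra.
- have -> : 1 + (y / (1 + w)) ^+ 2 = (1 + w ^+ 2 + y ^+ 2 + 2 * w) / (1 + w) ^+ 2.
    by field; rewrite gt_eqF.
  by rewrite w2; field; rewrite gt_eqF.
- by move=> yp; rewrite divr_gt0.
Qed.

Lemma half_angle_lt (R : realType) (r m T t : R) :
  r * (1 + m ^+ 2) = 2 * m -> T * (1 + t ^+ 2) = 2 * t -> 0 < m < 1 ->
  -1 < t < 1 -> - r < T < r -> - m < t < m.
Proof.
move=> rm Tt /andP[m0 m1] t1 /andP[T0 T1].
have [mt1 mt2] : 0 < 1 - t * m /\ 0 < 1 + t * m.
  by apply: (mul_near0_lt1 t1) => //; rewrite mul1r ltW.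
have M2 := mulr_gt0 (addr_1_sqr_gt0 m) (addr_1_sqr_gt0 t).
apply/andP; split.
  rewrite -subr_gt0 -(pmulr_lgt0 _ mt2) -(pmulr_rgt0 _ (ltr0Sn R 1)).
  rewrite [ltRHS](_ : _ = 2 * m * (1 + t ^+ 2) + 2 * t * (1 + m ^+ 2)); last by
      ring.
  rewrite -rm -Tt [ltRHS](_ : _ = (r + T) * ((1 + m ^+ 2) * (1 + t ^+ 2))); last
      by ring.
  by rewrite mulr_gt0 //; lra.
rewrite -subr_gt0 -(pmulr_lgt0 _ mt1) -(pmulr_rgt0 _ (ltr0Sn R 1)).
rewrite [ltRHS](_ : _ = 2 * m * (1 + t ^+ 2) - 2 * t * (1 + m ^+ 2)); last by ring.
rewrite -rm -Tt [ltRHS](_ : _ = (r - T) * ((1 + m ^+ 2) * (1 + t ^+ 2))); last by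
    ring.
by rewrite mulr_gt0 //; lra.
Qed.

(** Here [a1], [a2] are the fourth roots of [1 - alpha], [1 + alpha], and [b1], [b2] those of
    [1 + beta], [1 - beta]. In them [s] and [t0] are rational, with [r = s ^ 2] and
    [2 t / (1 + t ^ 2) = s * t0]; the half-angle lemma then yields [m] and [t]. *)
Lemma two_intervals_lower_roots (R : realType) (a1 a2 b1 b2 M : R) (p : {poly R})
    n :
  0 < a1 -> 0 < a2 -> 0 < b1 -> 0 < b2 -> b2 < a1 -> a2 < b1 ->
  a1 ^+ 4 + a2 ^+ 4 = 2 -> b1 ^+ 4 + b2 ^+ 4 = 2 ->
  p \is monic -> size p = n.+2 ->
  (forall x, two_intervals (1 - a1 ^+ 4) (1 - b2 ^+ 4) x -> `|p.[x]| <= M) ->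
  2 * (((a1 * a2 + b1 * b2) / (a1 * b1 + a2 * b2)) ^+ 4 / 2) ^+ n.+1 <= M.
Proof.
move=> a10 a20 b10 b20 ba ab aE bE pm sp pM.
pose a := a1 * a2; pose b := b1 * b2; pose c := a1 * b1; pose d := a2 * b2.
have [a0 b0 c0 d0] : [/\ 0 < a, 0 < b, 0 < c & 0 < d] by rewrite !mulr_gt0.
have cd0 : c + d != 0 by rewrite gt_eqF // addr_gt0.
have ab0 : b + a != 0 by rewrite gt_eqF // addr_gt0.
pose s := (c - d) / (c + d); pose t0 := (b - a) / (b + a).
have dc : d < c by rewrite /c /d mulrC ltr_pM // ltW.
have s01 : 0 < s < 1.
  by rewrite /s ltr_pdivlMr ?ltr_pdivrMr ?addr_gt0 // mul0r; apply/andP; split; lra.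
have /andP[s0 s1] := s01.
have k0 : 0 < (c + d) * (b + a) by rewrite mulr_gt0 // addr_gt0.
have t0s : t0 < s.
  rewrite -subr_gt0 (_ : s - t0 = 2 * (c * a - d * b) / ((c + d) * (b + a))).
    rewrite divr_gt0 // mulr_gt0 // subr_gt0.
    rewrite /a /b /c /d (_ : a2 * b2 * (b1 * b2) = b2 ^+ 2 * (a2 * b1)); last by
        ring.
    rewrite (_ : a1 * b1 * (a1 * a2) = a1 ^+ 2 * (a2 * b1)); last by ring.
    by rewrite ltr_pM2r ?mulr_gt0 // ltr_pXn2r // nnegrE ltW.
  by rewrite /s /t0; field; apply/andP.
have t0s' : - s < t0.
  rewrite -subr_gt0 (_ : t0 - - s = 2 * (c * b - d * a) / ((c + d) * (b + a))).
    rewrite divr_gt0 // mulr_gt0 // subr_gt0.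
    rewrite /a /b /c /d (_ : a2 * b2 * (a1 * a2) = a2 ^+ 2 * (a1 * b2)); last by
        ring.
    rewrite (_ : a1 * b1 * (b1 * b2) = b1 ^+ 2 * (a1 * b2)); last by ring.
    by rewrite ltr_pM2r ?mulr_gt0 // ltr_pXn2r // nnegrE ltW.
  by rewrite /s /t0; field; apply/andP.
have r01 : 0 < s ^+ 2 < 1 by rewrite exprn_gt0 //= exprn_ilt1 // ltW.
have /andP[r0 r1] := r01.
have T1 : - s ^+ 2 < s * t0 < s ^+ 2.
  by rewrite expr2 -mulrN !ltr_pM2l // t0s' t0s.
have [m [/andP[_ m1] rm m0]] : exists x, [/\ -1 < x < 1, s ^+ 2 * (1 + x ^+ 2) =
    2 * x & 0 < s ^+ 2 -> 0 < x].
  by apply: half_angle; rewrite r1 andbT (lt_trans _ r0) // oppr_lt0.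
have m01 : 0 < m < 1 by rewrite m0.
have [t [t1 Tt _]] : exists x, [/\ -1 < x < 1, s * t0 * (1 + x ^+ 2) = 2 * x & 0
    < s * t0 -> 0 < x].
  apply: half_angle; move: T1 => /andP[Tl Tr]; apply/andP; split; lra.
have tm := half_angle_lt rm Tt m01 t1 T1.
have -> : (a1 * a2 + b1 * b2) / (a1 * b1 + a2 * b2) = (a + b) / (c + d) by [].
have u0 := addr_1_sqr_gt0 t.
have tE1 : (1 - t) ^+ 2 = (1 - s * t0) * (1 + t ^+ 2) by rewrite mulrBl Tt; ring.
have tE2 : (1 + t) ^+ 2 = (1 + s * t0) * (1 + t ^+ 2) by rewrite mulrDl Tt; ring.
(* By [aE] and [bE] the difference [b1 ^ 4 - a2 ^ 4] equals [a1 ^ 4 - b2 ^ 4], so the same [q]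
   serves both products and drops out of the end point equations. *)
pose q := 4 * (b1 ^+ 4 - a2 ^+ 4) / ((c + d) * (b + a)) ^+ 2; pose e := 2 / (c + d).
have qE1 : (1 + s * t0) * (s + t0) = a1 ^+ 2 * b2 ^+ 2 * q.
  have -> : a1 ^+ 2 * b2 ^+ 2 * q = 4 * (c ^+ 2 * b ^+ 2 - d ^+ 2 * a ^+ 2) / ((c
      + d) * (b + a)) ^+ 2.
    by rewrite /q /a /b /c /d; field; apply/andP.
  by rewrite /s /t0; field; apply/andP.
have qE2 : (1 - s * t0) * (s - t0) = a2 ^+ 2 * b1 ^+ 2 * q.
  have -> : a2 ^+ 2 * b1 ^+ 2 * q = 4 * (c ^+ 2 * a ^+ 2 - d ^+ 2 * b ^+ 2) / ((c
      + d) * (b + a)) ^+ 2.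
    have -> : q = 4 * (a1 ^+ 4 - b2 ^+ 4) / ((c + d) * (b + a)) ^+ 2.
      by rewrite /q; congr (4 * _ / _); lra.
    by rewrite /a /b /c /d; field; apply/andP.
  by rewrite /s /t0; field; apply/andP.
have sE1 : 1 - s = e * d by rewrite /s /e; field.
have sE2 : 1 + s = e * c by rewrite /s /e; field.
(* The right side reduces to the square of [(1 - s ^ 2) / (1 - t0 ^ 2)], where the numerator is
   [4 a b / (c + d) ^ 2] because [c d = a b], and the denominator is [4 a b / (a + b) ^ 2]. *)
have -> : ((a + b) / (c + d)) ^+ 4 = (s ^+ 2 * (1 - s ^+ 2) * (1 + t ^+ 2) ^+ 2 /
   (s ^+ 2 * (1 + t ^+ 2) ^+ 2 - 4 * t ^+ 2)) ^+ 2.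
  have -> : 4 * t ^+ 2 = (s * t0 * (1 + t ^+ 2)) ^+ 2 by rewrite Tt; ring.
  have tt : 1 - t0 ^+ 2 = 4 * (a * b) / (b + a) ^+ 2 by rewrite /t0; field.
  have tt0 : 1 - t0 ^+ 2 != 0 by rewrite tt gt_eqF // divr_gt0 ?exprn_gt0
      ?mulr_gt0 ?addr_gt0.
  have -> : s ^+ 2 * (1 + t ^+ 2) ^+ 2 - (s * t0 * (1 + t ^+ 2)) ^+ 2
     = s ^+ 2 * (1 + t ^+ 2) ^+ 2 * (1 - t0 ^+ 2) by ring.
  have -> : s ^+ 2 * (1 - s ^+ 2) * (1 + t ^+ 2) ^+ 2 = s ^+ 2 * (1 + t ^+ 2) ^+
      2 * (e ^+ 2 * (a * b)).
    have -> : 1 - s ^+ 2 = (1 - s) * (1 + s) by ring.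
    by rewrite sE1 sE2 /a /b /c /d; ring.
  rewrite -mulf_div divff ?mul1r; last by rewrite mulf_neq0 // expf_neq0 // gt_eqF.
  rewrite tt /e; field.
  by rewrite cd0 ab0 !gt_eqF.
apply: (two_intervals_lower (r := s ^+ 2) (m := m) (t := t) (s := s) _ _ _ _ _ _
    _ _ _ _ pm sp pM) => //.
- by have := exprn_gt0 4 a20; lra.
- by rewrite ltrBlDr ltrDl exprn_gt0.
- have -> : 1 + (1 - b2 ^+ 4) = b1 ^+ 4 by lra.
  rewrite -Tt tE1 tE2 sE1 sE2.
  have -> : b1 ^+ 4 * ((1 + s * t0) * (1 + t ^+ 2) * (s ^+ 2 * (1 + t ^+ 2) + s *
      t0 * (1 + t ^+ 2)) * (e * d) ^+ 2)
     = b1 ^+ 4 * s * (1 + t ^+ 2) ^+ 2 * ((1 + s * t0) * (s + t0)) * (e * d) ^+ 2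
         by ring.
  have -> : (1 - (1 - b2 ^+ 4)) * ((1 - s * t0) * (1 + t ^+ 2) * (s ^+ 2 * (1 + t
      ^+ 2) - s * t0 * (1 + t ^+ 2)) * (e * c) ^+ 2)
     = b2 ^+ 4 * s * (1 + t ^+ 2) ^+ 2 * ((1 - s * t0) * (s - t0)) * (e * c) ^+ 2
         by ring.
  by rewrite qE1 qE2 /c /d; ring.
- have -> : 1 + (1 - a1 ^+ 4) = a2 ^+ 4 by lra.
  rewrite -Tt tE1 tE2 sE1 sE2.
  have -> : a2 ^+ 4 * ((1 + s * t0) * (1 + t ^+ 2) * (s ^+ 2 * (1 + t ^+ 2) + s *
      t0 * (1 + t ^+ 2)) * (e * c) ^+ 2)
     = a2 ^+ 4 * s * (1 + t ^+ 2) ^+ 2 * ((1 + s * t0) * (s + t0)) * (e * c) ^+ 2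
         by ring.
  have -> : (1 - (1 - a1 ^+ 4)) * ((1 - s * t0) * (1 + t ^+ 2) * (s ^+ 2 * (1 + t
      ^+ 2) - s * t0 * (1 + t ^+ 2)) * (e * d) ^+ 2)
     = a1 ^+ 4 * s * (1 + t ^+ 2) ^+ 2 * ((1 - s * t0) * (s - t0)) * (e * d) ^+ 2
         by ring.
  by rewrite qE1 qE2 /c /d; ring.
Qed.

(** * Capacity *)

Lemma nroot_const_cvg (R : realType) (C : R) :
  0 < C -> nroot n C @[n --> \oo] --> (1 : R).
Proof.
move=> C0; rewrite -cvg_shiftS.
have -> : [sequence nroot n.+1 C]_n = (fun n => expR (ln C * harmonic n)).
  by apply/funext => n; rewrite /nroot /powR gt_eqF //= mulrC.
suff: expR (ln C * harmonic n) @[n --> \oo] --> expR (ln C * 0) by rewrite mulr0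
    expR0.
apply: continuous_cvg; first exact: continuous_expR.
by apply: cvgM; [exact: cvg_cst|exact: cvg_harmonic].
Qed.

Lemma nrootX (R : realType) (c : R) n : 0 <= c -> (0 < n)%N -> nroot n (c ^+ n) = c.
Proof.
move=> c0 n0; rewrite /nroot -powR_mulrn // -powRrM mulfV ?powRr1 //.
by rewrite pnatr_eq0 -lt0n.
Qed.

Lemma nrootK (R : realType) (c : R) n : 0 <= c -> (0 < n)%N -> nroot n c ^+ n = c.
Proof.
move=> c0 n0; rewrite /nroot -powR_mulrn ?powR_ge0 // -powRrM mulVf ?powRr1 //.
by rewrite pnatr_eq0 -lt0n.
Qed.

Lemma ler_nroot (R : realType) (x y : R) n : 0 <= x -> x <= y -> nroot n x <=
    nroot n y.
Proof.
move=> x0 xy; apply: ge0_ler_powR; rewrite ?nnegrE ?invr_ge0 ?ler0n //.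
exact: le_trans xy.
Qed.

Lemma nrootM (R : realType) (x y : R) n :
  0 <= x -> 0 <= y -> nroot n (x * y) = nroot n x * nroot n y.
Proof. exact: powRM. Qed.

(** Fekete's lemma in multiplicative form. The limit is the infimum of the roots: for
    [b = nroot m (L m)] close to it, division of [n] by [m] gives [L n <= b ^ n * C]. *)
Lemma fekete (R : realType) (L : nat -> R) (c : R) :
  0 < c -> (forall n, c ^+ n <= L n) -> (forall m n, L (m + n)%N <= L m * L n) ->
  exists l, [/\ nroot n (L n) @[n --> \oo] --> l, c <= l &
    forall n, (0 < n)%N -> l <= nroot n (L n)].
Proof.
move=> c0 cL subL.
have L0 n : 0 < L n by apply: lt_le_trans (cL n); rewrite exprn_gt0.
pose S := [set nroot n (L n) | n in [set n | (0 < n)%N]].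
have lS : lbound S c.
  by move=> _ [n /= n0 <-]; rewrite -(nrootX (ltW c0) n0) ler_nroot // exprn_ge0
      // ltW.
have nS : S !=set0 by exists (nroot 1 (L 1%N)); exists 1%N.
have hS : has_inf S by split => //; exists c.
pose l := inf S; exists l.
have lle n : (0 < n)%N -> l <= nroot n (L n).
  by move=> n0; apply: ge_inf; [exists c|exists n].
split=> //; last exact: lb_le_inf.
apply/cvgrPdist_le => e e0.
have [_ [m /= m0 <-] ml] := inf_adherent (divr_gt0 e0 (ltr0Sn _ 1)) hS.
set b := nroot m (L m) in ml.
have b0 : 0 < b by apply: powR_gt0.
have Lm : L m = b ^+ m by rewrite /b nrootK // ltW.
(* This constant dominates [L s / b ^ s] for every remainder [s < m], and its [n]-th root tends to
   [1]. *)
pose C : R := 1 + \sum_(s < m) L s / b ^+ s.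
have C0 : 0 < C.
  by rewrite ltr_pwDl // sumr_ge0 // => s _; rewrite divr_ge0 ?exprn_ge0 ?ltW.
have Lq q s : L (q * m + s)%N <= b ^+ (q * m) * L s.
  elim: q => [|q IH]; first by rewrite mul0n expr0 mul1r.
  rewrite mulSn -addnA exprD -mulrA; apply: le_trans (subL _ _) _.
  by rewrite Lm ler_pM2l // exprn_gt0.
have LC n : L n <= b ^+ n * C.
  rewrite (divn_eq n m); apply: le_trans (Lq _ _) _.
  rewrite exprD -mulrA ler_pM2l ?exprn_gt0 //.
  have sm : (n %% m < m)%N by rewrite ltn_mod.
  rewrite -ler_pdivrMl ?exprn_gt0 // mulrC /C (bigD1 (Ordinal sm)) //=.
  rewrite addrCA lerDl addr_ge0 // sumr_ge0 // => s _.
  by rewrite divr_ge0 ?exprn_ge0 ?ltW.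
have bC : b * nroot n C @[n --> \oo] --> b.
  suff: b * nroot n C @[n --> \oo] --> b * 1 by rewrite mulr1.
  by apply: cvgM; [exact: cvg_cst|exact: nroot_const_cvg].
have near1 : \forall n \near \oo, b * nroot n C < l + e.
  by apply: cvgr_lt bC _ _; rewrite /l; lra.
near=> n.
have n0 : (0 < n)%N by near: n; exact: nbhs_infty_gt.
have : nroot n (L n) <= b * nroot n C.
  rewrite -[b in leRHS](nrootX (ltW b0) n0) -nrootM ?exprn_ge0 ?(ltW b0) ?(ltW
      C0) //.
  by apply: ler_nroot => //; apply: ltW.
have : b * nroot n C < l + e by near: n.
have := lle n n0; rewrite ler_norml; lra.
Unshelve. all: by end_near.
Qed.

Lemma horner_bounded (R : realDomainType) (p : {poly R}) :
  exists B, forall x, `|x| <= 1 -> `|p.[x]| <= B.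
Proof.
exists (\sum_(i < size p) `|p`_i|) => x x1; rewrite horner_coef.
apply: le_trans (ler_norm_sum _ _ _) _; apply: ler_sum => i _.
by rewrite normrM normrX ler_piMr // exprn_ile1.
Qed.

Section Capacity.
Variables (R : realType) (E : set R).
Hypotheses (E0 : E !=set0) (E1 : forall x, E x -> `|x| <= 1).

Lemma ler_poly_norm (p : {poly R}) x : E x -> `|p.[x]| <= poly_norm E p.
Proof.
move=> Ex; apply: ub_le_sup; last by exists x.
by have [B pB] := horner_bounded p; exists B => _ [y Ey <-]; apply/pB/E1.
Qed.

Lemma poly_norm_le (p : {poly R}) M : (forall x, E x -> `|p.[x]| <= M) ->
    poly_norm E p <= M.
Proof.
move=> pM; have [x Ex] := E0; apply: ge_sup; first by exists `|p.[x]|; exists x.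
by move=> _ [y Ey <-]; apply: pM.
Qed.

Lemma cheb_min_le (p : {poly R}) n M :
  p \is monic -> size p = n.+1 -> (forall x, E x -> `|p.[x]| <= M) -> cheb_min E
      n <= M.
Proof.
move=> pm sp pM; apply: le_trans (poly_norm_le pM); apply: ge_inf; last by exists p.
exists 0 => _ [q _ <-]; have [x Ex] := E0.
exact: le_trans (normr_ge0 _) (ler_poly_norm q Ex).
Qed.

Lemma le_cheb_min n c :
  (forall p : {poly R}, p \is monic -> size p = n.+1 -> c <= poly_norm E p) ->
  c <= cheb_min E n.
Proof.
move=> cp; apply: lb_le_inf; last by move=> _ [p [pm sp] <-]; apply: cp.
by exists (poly_norm E 'X^n); exists 'X^n => //; rewrite /= monicXn size_polyXn.
Qed.

(** Products of monic polynomials make [cheb_min] submultiplicative, so Fekete's lemma gives the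
    limit. As this limit is an infimum, each single polynomial bounds the capacity from above. *)
Lemma cap_bounds c : 0 < c ->
  (forall (p : {poly R}) n M, p \is monic -> size p = n.+2 ->
     (forall x, E x -> `|p.[x]| <= M) -> 2 * c ^+ n.+1 <= M) ->
  c <= cap E /\ forall (p : {poly R}) n M, p \is monic -> size p = n.+2 ->
     (forall x, E x -> `|p.[x]| <= M) -> cap E <= nroot n.+1 M.
Proof.
move=> c0 lower.
have cL n : c ^+ n <= cheb_min E n.
  apply: le_cheb_min => p pm sp; case: n sp => [|n] sp.
    (* In degree zero the only monic polynomial is the constant [1]. *)
    have [x Ex] := E0; apply: le_trans (ler_poly_norm p Ex).
    have /monicP := pm; rewrite lead_coefE sp /= => p0.
    by rewrite expr0 (size1_polyC (eq_leq sp)) hornerC p0 normr1.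
  apply: le_trans (lower _ _ _ pm sp (@ler_poly_norm p)).
  by rewrite mulr2n mulrDl !mul1r lerDl exprn_ge0 // ltW.
have L0 n : 0 < cheb_min E n by apply: lt_le_trans (cL n); rewrite exprn_gt0.
have subL m n : cheb_min E (m + n) <= cheb_min E m * cheb_min E n.
  have pos k (p : {poly R}) : p \is monic -> size p = k.+1 -> 0 < poly_norm E p.
    by move=> pm sp; apply: lt_le_trans (L0 k) _; apply: (cheb_min_le pm sp) =>
        x; exact: ler_poly_norm.
  rewrite -ler_pdivrMr //; apply: le_cheb_min => p pm sp.
  rewrite ler_pdivrMr // mulrC -ler_pdivrMr ?(pos m) //; apply: le_cheb_min => q
      qm sq.
  rewrite ler_pdivrMr ?(pos m) //.
  apply: (@cheb_min_le (q * p)); first by rewrite monicMl.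
    by rewrite size_monicM ?monic_neq0 // sp sq addnS addSn addnC.
  move=> x Ex; rewrite hornerM normrM ler_pM // ler_poly_norm //.
have [l [Ll cl lL]] := fekete c0 cL subL.
have -> : cap E = l by apply: cvg_lim => //; exact: Rhausdorff.
split=> // p n M pm sp pM; apply: le_trans (lL n.+1 isT) _.
by apply: ler_nroot; [exact: ltW|exact: cheb_min_le pm sp pM].
Qed.

End Capacity.

(** The comparison with [A = x = (1 - 2 z) / (z - 2)], which maps [[-1, 1]] onto itself and has its
    pole at the finite point [2]. *)
Lemma interval_lower (R : realType) (p : {poly R}) n M :
  p \is monic -> size p = n.+2 -> (forall x, `|x| <= 1 -> `|p.[x]| <= M) ->
  2 * 2^-1 ^+ n.+1 <= M.
Proof.
move=> pm sp pM; pose X : {poly R} := 1 - 2 *: 'X; pose Y : {poly R} := 'X - 2%:P.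
have XE z : X.[z] = 1 - 2 * z by rewrite /X !hornerE.
have YE z : Y.[z] = z - 2 by rewrite /Y !hornerE.
have sX : (size X <= 2)%N.
  apply: size_add_deg; first by rewrite size_poly1.
  by rewrite size_polyN (leq_trans (size_scale_leq _ _)) // size_polyX.
have sY : (size Y <= 2)%N by rewrite size_XsubC.
pose F : set R := [set z | -1 <= z <= 1].
have := @comparison R F [set x | `|x| <= 1] X Y 1 X 1 2 1 n p M sX.
rewrite !mulr1 XE YE => /(_ sX sY (subrr _)) H.
have : `|1 - 2 * 2| ^+ n.+1 <= M * (2 ^+ n * `|1 - 2 * 2 : R| ^+ n.+1).
  apply: H => //.
  - move=> z /= /andP[z1 z2]; rewrite XE YE; split; first by apply/eqP; lra.
    have z20 : 0 < 2 - z by lra.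
    rewrite -[z - 2]opprB invrN mulrN normrN ler_norml ler_pdivlMr // ler_pdivrMr
        //.
    by apply/andP; split; lra.
  - by rewrite /F /= lexx andbT; lra.
  - by rewrite XE YE; lra.
  - move=> g gF; rewrite muln1.
    have [rs [srs urs ars rrs]] : zeros_in g (-1) 1 n.+1.
      apply: (@arc_zeros _ _ X Y _ _ (-1)) => //.
      - by lra.
      - by move=> z /andP[z1 z2]; rewrite YE; apply/eqP; lra.
      - by rewrite XE YE; lra.
      - by rewrite XE YE; lra.
    exists rs; split=> // z zrs; have /andP[z1 z2] := allP ars z zrs.
    by rewrite /F /= !ltW.
have d0 : 0 < `|1 - 2 * 2 : R| by rewrite normr_gt0; apply/eqP; lra.
rewrite mulrA ler_pMl ?exprn_gt0 // => M1; rewrite exprVn exprS invfM mulrA divff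
    ?pnatr_eq0 // mul1r.
by rewrite -[_^-1]mul1r ler_pdivrMr ?exprn_gt0.
Qed.

(** The witness is the Chebyshev polynomial of [[m - h, m + h]], made monic by the leading
    coefficient [2 ^ n] of its homogeneous form. *)
Lemma chebyshev_monic (R : realType) (m h : R) n : 0 < h ->
  exists p : {poly R}, [/\ p \is monic, size p = n.+2 &
    forall x, `|x - m| <= h -> `|p.[x]| <= 2 * (h / 2) ^+ n.+1].
Proof.
move=> h0; pose c k := cheb ('X - m%:P) h%:P k.
have s1 : (size ('X - m%:P)%R <= 2)%N by rewrite size_XsubC.
have sc k : (size (c k) <= k.+1)%N.
  by rewrite -[k in k.+1]muln1; apply: size_cheb => //; apply: leq_trans
      (size_polyC_leq1 _) _.
have lc k : (c k.+1)`_k.+1 = 2 ^+ k.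
  elim: k => [|k IH]; first by rewrite coefB coefX coefC subr0 expr0.
  rewrite /c chebSS -/(c k.+1) -/(c k) coefB -polyC_exp mul_polyC coefZ.
  rewrite [(c k)`_ _]nth_default ?mulr0 ?subr0; last by rewrite (leq_trans (sc k)).
  rewrite mulr_natl mulrnAl coefMn mulrBl coefB coefXM mul_polyC coefZ /=.
  rewrite [(c k.+1)`_k.+2]nth_default ?sc // mulr0 subr0 IH exprS.
  by rewrite mulr_natl.
have c0 : (2 ^+ n)^-1 != 0 :> R by rewrite invr_neq0 // expf_neq0 // pnatr_eq0.
exists ((2 ^+ n)^-1 *: c n.+1).
have szc : size (c n.+1) = n.+2.
  apply/eqP; rewrite eqn_leq sc ltnNge; apply/negP => /leq_sizeP /(_ n.+1 (leqnn
      _)).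
  by move/eqP; rewrite lc expf_eq0 pnatr_eq0 andbF.
split.
- by rewrite monicE lead_coefZ lead_coefE szc lc mulVf // expf_neq0 // pnatr_eq0.
- by rewrite size_scale.
- move=> x xh; rewrite hornerZ normrM ger0_norm ?invr_ge0 ?exprn_ge0 //.
  rewrite /c horner_cheb hornerXsubC hornerC.
  have u1 : -1 <= (x - m) / h <= 1.
    by rewrite ler_pdivlMr // ler_pdivrMr // mulN1r mul1r -ler_norml.
  have [_ cosu] := acos_def u1.
  have -> : x - m = cos (acos ((x - m) / h)) * h by rewrite cosu divfK // gt_eqF.
  rewrite cheb_cos normrM [`|h ^+ _|]ger0_norm ?exprn_ge0 ?(ltW h0) //.
  have -> : 2 * (h / 2) ^+ n.+1 = (2 ^+ n)^-1 * h ^+ n.+1.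
    by rewrite expr_div_n [2 ^+ n.+1]exprS; field; rewrite expf_neq0 ?pnatr_eq0.
  rewrite ler_pM2l ?invr_gt0 ?exprn_gt0 // ler_piMl ?exprn_ge0 ?(ltW h0) //.
  by rewrite ler_norml cos_geN1 cos_le1.
Qed.

(** * The constant [C1] and the lower bound for the capacity *)

Lemma C1_split (R : realType) (a b : R) : -1 <= a <= 1 -> -1 <= b <= 1 ->
  C1 a b = ((nroot 4 (1 - a) * nroot 4 (1 + a) + nroot 4 (1 + b) * nroot 4 (1 -
      b)) /
     (nroot 4 (1 - a) * nroot 4 (1 + b) + nroot 4 (1 + a) * nroot 4 (1 - b))) ^+
         4 / 2.
Proof.
move=> /andP[a0 a1] /andP[b0 b1]; rewrite /C1 -!nrootM; try lra.
have -> : 1 - a ^+ 2 = (1 - a) * (1 + a) by ring.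
have -> : 1 - b ^+ 2 = (1 + b) * (1 - b) by ring.
by rewrite mulrC.
Qed.

Lemma nroot4_gt0 (R : realType) (x : R) : 0 < x -> 0 < nroot 4 x.
Proof. exact: powR_gt0. Qed.

Lemma C1_gt0 (R : realType) (a b : R) : -1 < a < 1 -> -1 < b < 1 -> 0 < C1 a b.
Proof.
move=> /andP[a0 a1] /andP[b0 b1]; rewrite C1_split ?ltW ?a0 ?b0 //.
by rewrite divr_gt0 // exprn_gt0 // divr_gt0 // addr_gt0 // mulr_gt0 //
    nroot4_gt0; lra.
Qed.

Lemma C1_diag (R : realType) (a : R) : -1 < a < 1 -> C1 a a = 2^-1.
Proof.
move=> /andP[a0 a1]; rewrite /C1.
have -> : (1 - a) * (1 + a) = 1 - a ^+ 2 by ring.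
have -> : (1 + a) * (1 - a) = 1 - a ^+ 2 by ring.
rewrite divff ?expr1n ?mulr1 // gt_eqF // addr_gt0 // nroot4_gt0 //.
all: rewrite (_ : 1 - a ^+ 2 = (1 - a) * (1 + a)); last by ring.
all: by rewrite mulr_gt0 //; lra.
Qed.

Lemma cap_two_intervals (R : realType) (alpha beta : R) :
  -1 < alpha -> alpha <= beta -> beta < 1 ->
  C1 alpha beta <= cap (two_intervals alpha beta) /\
  forall (p : {poly R}) n M, p \is monic -> size p = n.+2 ->
    (forall x, two_intervals alpha beta x -> `|p.[x]| <= M) ->
    cap (two_intervals alpha beta) <= nroot n.+1 M.
Proof.
move=> a1 ab b1.
have a2 : -1 < alpha < 1 by rewrite a1 (le_lt_trans ab).
have b2 : -1 < beta < 1 by rewrite b1 (lt_le_trans a1).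
apply: cap_bounds.
- by exists (-1); left; rewrite /= in_itv /= lexx ltW.
- by move=> x [] /=; rewrite in_itv /= => /andP[x1 x2]; rewrite ler_norml; lra.
- exact: C1_gt0.
move=> p n M pm sp pM; move: ab; rewrite le_eqVlt => /predU1P[ab|ab].
  (* The components meet and form [[-1, 1]]; the parameters of the covering are set up for
     [alpha < beta]. *)
  rewrite -ab C1_diag //; apply: (interval_lower pm sp) => x; rewrite ler_norml
      => /andP[x1 x2].
  apply: pM; rewrite -ab; case: (leP x alpha) => xa; [left|right]; rewrite /=
      in_itv /=.
    by rewrite x1.
  by rewrite x2 ltW.
have itvW (x : R) : -1 < x < 1 -> -1 <= x <= 1 by move=> /andP[? ?]; rewrite !ltW.
rewrite (C1_split (itvW _ a2) (itvW _ b2)).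
have /andP[_ a3] := a2; have /andP[b3 _] := b2.
have rootK (x : R) : 0 < x -> nroot 4 x ^+ 4 = x by move=> x0; rewrite nrootK ?ltW.
have mono (x y : R) : 0 < x -> x < y -> nroot 4 x < nroot 4 y.
  move=> x0 xy; have y0 := lt_trans x0 xy.
  by rewrite -(@ltr_pXn2r _ 4) ?nnegrE ?ltW ?nroot4_gt0 // !rootK.
apply: (two_intervals_lower_roots _ _ _ _ _ _ _ _ pm sp).
- by rewrite nroot4_gt0 //; lra.
- by rewrite nroot4_gt0 //; lra.
- by rewrite nroot4_gt0 //; lra.
- by rewrite nroot4_gt0 //; lra.
- by apply: mono; lra.
- by apply: mono; lra.
- by rewrite !rootK; lra.
- by rewrite !rootK; lra.
- by rewrite !rootK ?subKr //; lra.
Qed.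

(** * Limits as one component shrinks *)

Lemma nroot4E (R : realType) (x : R) : 0 <= x -> nroot 4 x = Num.sqrt (Num.sqrt x).
Proof.
move=> x0; rewrite -!powR12_sqrt ?powR_ge0 // -powRrM /nroot; congr (_ `^ _).
by field.
Qed.

(** For [a = -1] or [b = 1] some radicands vanish; iterated square roots give continuity there as
    well. *)
Lemma C1_cvg (R : realType) (T : Type) (G : set_system T) {FG : Filter G}
    (f g : T -> R) (a b : R) :
  (\forall x \near G, -1 <= f x <= 1) -> (\forall x \near G, -1 <= g x <= 1) ->
  -1 <= a <= 1 -> -1 <= b <= 1 ->
  nroot 4 ((1 - a) * (1 + b)) + nroot 4 ((1 + a) * (1 - b)) != 0 ->
  f x @[x --> G] --> a -> g x @[x --> G] --> b -> C1 (f x) (g x) @[x --> G] -->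
      C1 a b.
Proof.
move=> f1 g1 /andP[a0 a1] /andP[b0 b1] d0 fa gb.
pose q (x : R) : R := Num.sqrt (Num.sqrt x).
pose D (u v : R) : R := 2^-1 * ((q (1 - u ^+ 2) + q (1 - v ^+ 2)) /
          (q ((1 - u) * (1 + v)) + q ((1 + u) * (1 - v)))) ^+ 4.
have DE u v : -1 <= u <= 1 -> -1 <= v <= 1 -> C1 u v = D u v.
  move=> /andP[u0 u1] /andP[v0 v1]; rewrite /C1 /D !nroot4E //.
  - by rewrite mulr_ge0 //; lra.
  - by rewrite mulr_ge0 //; lra.
  - by rewrite (_ : 1 - v ^+ 2 = (1 - v) * (1 + v)); [rewrite mulr_ge0 //;
      lra|ring].
  - by rewrite (_ : 1 - u ^+ 2 = (1 - u) * (1 + u)); [rewrite mulr_ge0 //;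
      lra|ring].
have qcont : continuous q.
  by move=> x; apply: (continuous_comp (@sqrt_continuous R _) (@sqrt_continuous R
      _)).
have qc (h : T -> R) (l : R) : h x @[x --> G] --> l -> q (h x) @[x --> G] --> q l.
  by move=> hl; apply: continuous_cvg => //; exact: qcont.
have cvgX k (h : T -> R) (l : R) : h x @[x --> G] --> l -> h x ^+ k @[x --> G]
    --> l ^+ k.
  move=> hl; elim: k => [|k IH]; first exact: cvg_cst.
  under eq_fun do rewrite exprS.
  by rewrite exprS; apply: cvgM.
rewrite (DE a b) ?a0 ?b0 //.
apply: (@cvg_trans _ (D (f x) (g x) @[x --> G])).
  by apply: near_eq_cvg; near=> x; rewrite DE //; near: x.
have d1 : q ((1 - a) * (1 + b)) + q ((1 + a) * (1 - b)) != 0.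
  by move: d0; rewrite !nroot4E // mulr_ge0 //; lra.
have N : q (1 - f x ^+ 2) + q (1 - g x ^+ 2) @[x --> G] --> q (1 - a ^+ 2) + q (1
    - b ^+ 2).
  by apply: cvgD; apply: qc; apply: cvgB; [exact: cvg_cst|exact: cvgX|exact:
      cvg_cst|exact: cvgX].
have L : q ((1 - f x) * (1 + g x)) + q ((1 + f x) * (1 - g x)) @[x --> G]
    --> q ((1 - a) * (1 + b)) + q ((1 + a) * (1 - b)).
  by apply: cvgD; apply: qc; apply: cvgM; (apply: cvgB || apply: cvgD) => //;
      exact: cvg_cst.
by apply: cvgM; [exact: cvg_cst|apply: cvgX; apply: cvgM => //; apply: cvgV].
Unshelve. all: by end_near.
Qed.

Lemma nroot_geometric_cvg (R : realType) (C l : R) : 0 < C -> 0 < l ->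
  nroot n.+1 (C * l ^+ n.+1) @[n --> \oo] --> l.
Proof.
move=> C0 l0.
have -> : (fun n => nroot n.+1 (C * l ^+ n.+1)) = (fun n => nroot n.+1 C * l).
  by apply/funext => n; rewrite nrootM ?exprn_ge0 ?(ltW C0) ?(ltW l0) // nrootX
      ?(ltW l0).
suff: nroot n.+1 C * l @[n --> \oo] --> 1 * l by rewrite mul1r.
apply: cvgM; last exact: cvg_cst.
by have := nroot_const_cvg C0; rewrite -cvg_shiftS.
Qed.

(* One zero at [e] makes the polynomial small on the whole shrinking component,
   at a cost that disappears under the [n]-th root. *)
Lemma cap_near_interval (R : realType) (m h e eps : R) :
  0 < h -> 0 < eps -> `|e| <= 1 -> exists2 delta, 0 < delta &
    forall E : set R, (forall x, E x -> `|x| <= 1) ->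
      (forall x, E x -> `|x - e| <= delta \/ `|x - m| <= h) ->
      (forall (p : {poly R}) n M, p \is monic -> size p = n.+2 ->
         (forall x, E x -> `|p.[x]| <= M) -> cap E <= nroot n.+1 M) ->
      cap E <= h / 2 + eps.
Proof.
move=> h0 eps0 e1; have l0 : 0 < h / 2 by rewrite divr_gt0.
have C0 : 0 < 4 / (h / 2) by rewrite divr_gt0.
(* The degree is fixed before [delta]. The extra factor satisfies [|x - e| <= 2] on [E], which turns
   the Chebyshev bound into [4 (h / 2) ^ (n + 1)], the quantity under the root. *)
have [n nlt] : exists n, nroot n.+2 (4 / (h / 2) * (h / 2) ^+ n.+2) < h / 2 + eps.
  have : \forall n \near \oo, nroot n.+1 (4 / (h / 2) * (h / 2) ^+ n.+1) < h / 2
      + eps.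
    by apply: (cvgr_lt _ (nroot_geometric_cvg C0 l0)); rewrite ltrDl.
  by case=> N _ /(_ N.+1 (leqnSn N)) NP; exists N.
have [q [qm sq qh]] := @chebyshev_monic R m h n h0.
have [B qB] := horner_bounded q.
have B0 : 0 <= B by apply: le_trans (qB 0 _); rewrite ?normr0.
pose M := 4 / (h / 2) * (h / 2) ^+ n.+2.
have M0 : 0 < M by rewrite mulr_gt0 // exprn_gt0.
have ME : M = 2 * (2 * (h / 2) ^+ n.+1).
  by rewrite /M [_ ^+ n.+2]exprS; field; rewrite gt_eqF.
(* With [|q| <= B] on [[-1, 1]], the product stays below [M] within this distance of [e]. *)
exists (M / (B + 1)); first by rewrite divr_gt0 // ltr_wpDl.
move=> E E1 Eh capE; apply: le_trans (ltW nlt).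
apply: (capE (('X - e%:P) * q)).
- by rewrite monicMl // monicXsubC.
- by rewrite size_monicM ?monicXsubC ?monic_neq0 // size_XsubC sq.
move=> x Ex; rewrite hornerM hornerXsubC normrM -/M.
have [xe|xm] := Eh x Ex.
  apply: (@le_trans _ _ (M / (B + 1) * B)).
    by rewrite ler_pM // qB // E1.
  rewrite -mulrA ger_pMr // mulrC ler_pdivrMr ?mul1r ?lerDl //.
  by rewrite ltr_wpDl.
rewrite ME ler_pM // ?qh //.
apply: le_trans (ler_normB _ _) _.
by have := E1 x Ex; lra.
Qed.

(** A squeeze whose upper bound is known only up to each [eps], as [cap_near_interval] provides
    it. *)
Lemma cvg_between (R : realType) (T : Type) (G : set_system T) {FG : Filter G}
    (c f : T -> R) (l : R) :
  c x @[x --> G] --> l -> (\forall x \near G, c x <= f x) ->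
  (forall eps, 0 < eps -> \forall x \near G, f x <= l + eps) -> f x @[x --> G]
      --> l.
Proof.
move=> /cvgrPdist_le cl cf fl; apply/cvgrPdist_le => eps eps0; near=> x.
have : `|l - c x| <= eps by near: x; exact: cl.
have : c x <= f x by near: x.
have : f x <= l + eps by near: x; exact: fl.
by rewrite !ler_norml => ? ? /andP[? ?]; apply/andP; split; lra.
Unshelve. all: by end_near.
Qed.

(** The value is a quarter of the length of the surviving interval [[b, 1]], which is its
    capacity. *)
Lemma C1_left (R : realType) (b : R) : -1 < b < 1 -> C1 (-1) b = (1 - b) / 4.
Proof.
move=> /andP[b0 b1]; rewrite C1_split; [|lra|lra].
have r2 : nroot 4 (1 - -1 : R) ^+ 4 = 2 by rewrite nrootK //; lra.
have rb : nroot 4 (1 - b) ^+ 4 = 1 - b by rewrite nrootK //; lra.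
have r20 : 0 < nroot 4 (1 - -1 : R) by rewrite nroot4_gt0 //; lra.
have rb0 : 0 < nroot 4 (1 + b) by rewrite nroot4_gt0 //; lra.
have -> : nroot 4 (1 + -1 : R) = 0 by rewrite subrr /nroot powR0 // invr_eq0
    pnatr_eq0.
rewrite mulr0 add0r mul0r addr0.
rewrite [nroot 4 (1 - -1) * _]mulrC -mulf_div divff ?gt_eqF // mul1r.
by rewrite expr_div_n rb r2; field.
Qed.

Lemma C1_right (R : realType) (a : R) : -1 < a < 1 -> C1 a 1 = (1 + a) / 4.
Proof.
move=> /andP[a0 a1]; rewrite C1_split; [|lra|lra].
have r2 : nroot 4 (1 + 1 : R) ^+ 4 = 2 by rewrite nrootK //; lra.
have ra : nroot 4 (1 + a) ^+ 4 = 1 + a by rewrite nrootK //; lra.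
have r20 : 0 < nroot 4 (1 + 1 : R) by rewrite nroot4_gt0 //; lra.
have ra0 : 0 < nroot 4 (1 - a) by rewrite nroot4_gt0 //; lra.
have -> : nroot 4 (1 - 1 : R) = 0 by rewrite subrr /nroot powR0 // invr_eq0
    pnatr_eq0.
rewrite !mulr0 !addr0 -mulf_div divff ?gt_eqF // mul1r.
by rewrite expr_div_n ra r2; field.
Qed.

Theorem theorem5 (R : realType) :
  [/\ (forall alpha beta : R, -1 < alpha -> alpha <= beta -> beta < 1 ->
         C1 alpha beta <= cap (two_intervals alpha beta)),
      (forall alpha beta : R, -1 < alpha -> alpha <= beta -> beta < 1 ->
         alpha = beta -> cap (two_intervals alpha beta) = C1 alpha beta),
      (forall beta : R, -1 < beta -> beta < 1 -> exists l : R,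
         cap (two_intervals alpha beta) @[alpha --> (-1)^'+] --> l /\
         C1 alpha beta @[alpha --> (-1)^'+] --> l) &
      (forall alpha : R, -1 < alpha -> alpha < 1 -> exists l : R,
         cap (two_intervals alpha beta) @[beta --> 1^'-] --> l /\
         C1 alpha beta @[beta --> 1^'-] --> l)].
Proof.
have inside (a b x : R) : -1 < a -> a <= b -> b < 1 -> two_intervals a b x ->
    `|x| <= 1.
  by move=> a0 ab b1 [] /=; rewrite in_itv /= => /andP[? ?]; rewrite ler_norml; lra.
split.
- by move=> a b a0 ab b1; have [] := cap_two_intervals a0 ab b1.
- move=> a b a0 ab b1 abE; have [lower upper] := cap_two_intervals a0 ab b1.
  apply/eqP; rewrite eq_le lower andbT; subst b; rewrite C1_diag ?a0 //.
  (* The monic Chebyshev polynomials of [[-1, 1]] bound the capacity by a sequence of roots that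
     tends to [1 / 2]. *)
  have lim := @nroot_geometric_cvg R 2 2^-1 (ltr0Sn _ _) _.
  have lim2 : nroot n.+1 (2 * 2^-1 ^+ n.+1) @[n --> \oo] --> (2^-1 : R) by apply:
      lim; rewrite invr_gt0.
  have lE := cvg_lim (@Rhausdorff R) lim2.
  rewrite -lE; apply: limr_ge; first by apply/cvg_ex; exists 2^-1.
  near=> n; have [p [pm sp ph]] := @chebyshev_monic R 0 1 n ltr01.
  apply: (upper p n _ pm sp) => x xE; rewrite -[2^-1]mul1r; apply: ph.
  by rewrite subr0; exact: inside xE.
- move=> b b0 b1; exists (C1 (-1) b).
  have C1l : C1 alpha b @[alpha --> (-1)^'+] --> C1 (-1) b.
    apply: C1_cvg.
    + near=> a; apply/andP; split; first by apply: ltW; near: a; exact: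
        nbhs_right_gt.
      by apply: ltW; near: a; apply: nbhs_right_lt; lra.
    + by near=> a; rewrite !ltW.
    + by lra.
    + by rewrite !ltW.
    + rewrite gt_eqF // ltr_pwDl ?powR_ge0 // nroot4_gt0 // mulr_gt0 //; lra.
    + exact: cvg_at_right_filter cvg_id.
    + exact: cvg_cst.
  split=> //; apply: cvg_between C1l _ _.
    near=> a; have [|||//] := @cap_two_intervals R a b.
    + by near: a; exact: nbhs_right_gt.
    + by apply: ltW; near: a; exact: nbhs_right_lt.
    + by [].
  move=> eps eps0; rewrite C1_left ?b0 //.
  (* Midpoint and half length of the surviving interval [[b, 1]]; the additional zero sits at [-1],
     to which the other component shrinks. *)
  have [||delta d0 dP] := @cap_near_interval R ((1 + b) / 2) ((1 - b) / 2) (-1)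
      eps _ eps0.
  + by lra.
  + by rewrite normrN1.
  near=> a; rewrite (_ : (1 - b) / 4 = (1 - b) / 2 / 2); last by field.
  have a0 : -1 < a by near: a; exact: nbhs_right_gt.
  have ab : a <= b by apply: ltW; near: a; exact: nbhs_right_lt.
  have ad : a <= -1 + delta by apply: ltW; near: a; apply: nbhs_right_lt; rewrite
      ltrDl.
  have [_ upper] := cap_two_intervals a0 ab b1.
  apply: dP upper; first by move=> x; exact: inside.
  by move=> x [] /=; rewrite in_itv /= => /andP[x1 x2]; [left|right]; rewrite
      ler_norml; lra.
- move=> a a0 a1; exists (C1 a 1).
  have C1l : C1 a beta @[beta --> 1^'-] --> C1 a 1.
    apply: C1_cvg.
    + by near=> b; rewrite !ltW.
    + near=> b; apply/andP; split; last by apply: ltW; near: b; exact: nbhs_left_lt.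
      by apply: ltW; near: b; apply: nbhs_left_gt; lra.
    + by rewrite !ltW.
    + by lra.
    + rewrite gt_eqF // ltr_pwDl ?powR_ge0 // nroot4_gt0 // mulr_gt0 //; lra.
    + exact: cvg_cst.
    + exact: cvg_at_left_filter cvg_id.
  split=> //; apply: cvg_between C1l _ _.
    near=> b; have [|||//] := @cap_two_intervals R a b.
    + by [].
    + by apply: ltW; near: b; exact: nbhs_left_gt.
    + by near: b; exact: nbhs_left_lt.
  move=> eps eps0; rewrite C1_right ?a0 //.
  have [||delta d0 dP] := @cap_near_interval R ((a - 1) / 2) ((1 + a) / 2) 1 eps
      _ eps0.
  + by lra.
  + by rewrite normr1.
  near=> b; rewrite (_ : (1 + a) / 4 = (1 + a) / 2 / 2); last by field.
  have b1 : b < 1 by near: b; exact: nbhs_left_lt.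
  have ab : a <= b by apply: ltW; near: b; exact: nbhs_left_gt.
  have bd : 1 - delta <= b by apply: ltW; near: b; apply: nbhs_left_gt; rewrite
      ltrBlDr ltrDl.
  have [_ upper] := cap_two_intervals a0 ab b1.
  apply: dP upper; first by move=> x; exact: inside.
  by move=> x [] /=; rewrite in_itv /= => /andP[x1 x2]; [right|left]; rewrite
      ler_norml; lra.
Unshelve. all: by end_near.
Qed.
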